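(* Let $n\ge 1$ and let $A=(a_{ij})_{1\le i<j\le 2n}$ be a skew-symmetric $2n\times 2n$ matrix. Suppose $I\subset[2n]$ is a subset of even cardinality. Then $$\mathrm{pf}_{I,\bar I}(A)=\sum_{D\in\mathcal{D}_{\max}(I)}\mathrm{Pfaf}_D(A).$$
   Context: Pfaffians. $[2n]=\{1,\dots,2n\}$. A skew-symmetric matrix is identified with the array $(a_{ij})_{i<j}$ of its entries above the diagonal. $F_{2n}$ is the set of perfect matchings $\pi$ of $[2n]$, and $a_\pi=\prod_{(i<j)\in\pi}a_{ij}$. The pfaffian is $\mathrm{pf}(A)=\sum_{\pi\in F_{2n}}(-1)^{\mathrm{cn}(\pi)}a_\pi$, where $\mathrm{cn}(\pi)$ is the number of crossings of the arcs of $\pi$ when the vertices are placed in order on a line and the edges drawn as arcs above it. For $I\subset[2n]$ of even size, $\mathrm{pf}_I(A)$ is the pfaffian of the submatrix with rows and columns in $I$ ($\mathrm{pf}_\emptyset=1$), $\bar I=[2n]\setminus I$, and $\mathrm{pf}_{I,\bar I}(A)=\mathrm{pf}_I(A)\,\mathrm{pf}_{\bar I}(A)$. Symmetric TL-diagrams. Place points $1,\dots,2n$ on the left side and $1',\dots,(2n)'$ on the right side of a rectangle, numbered from top to bottom. A TL-diagram is a non-crossing perfect matching of these $4n$ points (drawn inside the rectangle); it is symmetric if invariant under the mirror reflection $i\leftrightarrow i'$. Then every edge is either horizontal, of the form $(i,i')$, or belongs to a mirror pair of vertical edges $\{(i,j),(i',j')\}$. The order $|D|$ is the number of edges with both ends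 on the left side. $\mathcal{T}_n$ is the set of symmetric TL-diagrams and $\mathcal{T}^e_n$ the subset of those with $|D|$ even. Diagram pfaffinants. For $\pi\in F_{2n}$ let $\nu(\pi)$ be the matching of $[2n]\cup[2n]'$ with edges $(i,j')$ and $(i',j)$ for each $(i,j)\in\pi$. Fix for each $\pi$ a nice embedding of $\nu(\pi)$: all edges lie in the rectangle, every pair of edges meets at most once, the picture is mirror symmetric, no two edges are tangent, no three edges pass through one point. An unpaired crossing is a crossing of $(i,j')$ with its mirror image $(i',j)$; all other crossings come in mirror-symmetric pairs (paired crossings). Each edge joins the left side to the right side, so at a crossing of two edges there are two half-edges leading to left endpoints and two leading to right endpoints. The vertical uncrossing replaces the crossing by one strand joining the two left half-edges and one joining the two right half-edges (picture '')(''); the horizontal uncrossing joins the left half-edge of each edge to the right half-edge of the other edge without crossing. $X(\pi)$ is the set of diagrams obtained by uncrossing every crossing of $\nu(\pi)$ in one of the two ways, the two members of a paired crossing being uncrossed in the same way. Each $x\in X(\pi)$ is mirror symmetric, and is topologically an element $D(x)\in\mathcal{T}_n$ together with some closed loops. Set $\mathrm{wt}(x)=2^{l(x)}(-1)^{\mathrm{uv}(x)+\mathrm{ph}(x)}$, where $l(x)$ is the number of closed loops (a pair of mirror-symmetric loops counted once), $\mathrm{uv}(x)$ the number of unpaired crossings uncrossed vertically, and $\mathrm{ph}(x)$ the number of pairs of paired crossings uncrossed horizontally. Put $f_D(\pi)=\sum_{x\in X(\pi),\,D(x)=D}\mathrm{wt}(x)$ and $\mathrm{Pfaf}'_D(A)=\sum_{\pi\in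 F_{2n}}f_D(\pi)\,a_\pi$ for $D\in\mathcal{T}_n$. TL-pfaffinants. A vertical left edge $(i,j)$ with $i<j$ is odd if $i$ is odd, even otherwise. For $D\in\mathcal{T}_n$, $S(D)$ is the set of all diagrams in $\mathcal{T}_n$ obtained from $D$ by erasing several (possibly zero) odd edges and their mirror images, and matching the resulting unmatched vertices by horizontal edges $(i,i')$. For $D\in\mathcal{T}^e_n$, $\mathrm{Pfaf}_D(A)=\sum_{D'\in S(D)}\mathrm{Pfaf}'_{D'}(A)$. Compatibility. The $I$-coloring of $[2n]\cup[2n]'$ colors $I\cup(\bar I)'$ black and $I'\cup\bar I$ white. $D\in\mathcal{T}_n$ is $I$-compatible if each edge of $D$ has ends of different colors; $\mathcal{D}(I)$ is the set of $I$-compatible diagrams. For $|I|$ even and $D'\in\mathcal{D}(I)$ there is a unique $D_{\max}\in\mathcal{T}^e_n\cap\mathcal{D}(I)$ with $D'\in S(D_{\max})$ and such that $S(D)\subset S(D_{\max})$ whenever $D\in\mathcal{D}(I)$ and $D'\in S(D)$. $\mathcal{D}_{\max}(I)\subset\mathcal{T}_n^e$ is the set of all diagrams $D_{\max}$ arising in this way from some $D'\in\mathcal{D}(I)$. *)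

(* Defs.v *)
From HB Require Import structures.
From mathcomp Require Import all_boot all_order all_algebra.
Set Implicit Arguments.
Unset Strict Implicit.
Unset Printing Implicit Defensive.
Import GRing.Theory.

(* Indices are 0-based: the vertex i of [2n] is the ordinal i - 1 of
   'I_(n.*2), so "i is odd" reads "the ordinal is even". *)

(* A perfect matching of T is given by its partner function, a fixed-point
   free involution. *)
Definition perfect_matching (T : finType) (f : {ffun T -> T}) : bool :=
  [forall x, (f x != x) && (f (f x) == x)].

(* Pairs of crossing arcs, for vertices placed on a line by pos; each crossing
   is listed once, through the left ends of its two arcs. *)
Definition crossings (T : finType) (pos : T -> nat) (f : {ffun T -> T}) :
    {set T * T} :=
  [set p | [&& pos p.1 < pos p.2, pos p.2 < pos (f p.1)
             & pos (f p.1) < pos (f p.2)]].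

Definition cn (m : nat) (f : {ffun 'I_m -> 'I_m}) : nat :=
  #|crossings (@nat_of_ord m) f|.

Section Pfaffian.
Local Open Scope ring_scope.
Variable R : comNzRingType.

Definition match_weight (m : nat) (A : 'M[R]_m) (f : {ffun 'I_m -> 'I_m}) : R :=
  \prod_(i : 'I_m | (i < f i)%N) A i (f i).

Definition pf (m : nat) (A : 'M[R]_m) : R :=
  \sum_(f : {ffun 'I_m -> 'I_m} | perfect_matching f)
    (-1) ^+ cn f * match_weight A f.

(* enum_val lists the elements of I in increasing order. *)
Definition pf_sub (m : nat) (I : {set 'I_m}) (A : 'M[R]_m) : R :=
  pf (mxsub (@enum_val _ (mem I)) (@enum_val _ (mem I)) A).

Definition pf_pair (m : nat) (I : {set 'I_m}) (A : 'M[R]_m) : R :=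
  pf_sub I A * pf_sub (~: I) A.

End Pfaffian.

(* (false, i) is the left vertex i, (true, i) is the right vertex i'. *)
Definition point (n : nat) : Type := (bool * 'I_n.*2)%type.

Definition mirror (n : nat) (p : point n) : point n := (~~ p.1, p.2).

(* Position along the boundary of the rectangle: down the left side, then up
   the right side. *)
Definition bpos (n : nat) (p : point n) : nat :=
  if p.1 then (n.*2.*2).-1 - p.2 else p.2.

Definition diagram (n : nat) : Type := {ffun point n -> point n}.

Definition symTL (n : nat) : {set diagram n} :=
  [set D | [&& perfect_matching D, crossings (@bpos n) D == set0
             & [forall p, D (mirror p) == mirror (D p)]]].

(* Edges with both ends on the left, as pairs (i, j) with i < j. *)
Definition left_edges (n : nat) (D : diagram n) : {set 'I_n.*2 * 'I_n.*2} :=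
  [set e : 'I_n.*2 * 'I_n.*2 | (e.1 < e.2) && (D (false, e.1) == (false, e.2))].

Definition order_TL (n : nat) (D : diagram n) : nat := #|left_edges D|.

Definition symTL_even (n : nat) : {set diagram n} :=
  [set D in symTL n | ~~ odd (order_TL D)].

Definition odd_edges (n : nat) (D : diagram n) : {set 'I_n.*2 * 'I_n.*2} :=
  [set e in left_edges D | ~~ odd e.1].

(* Erase the edges in E and their mirror images, and join each vertex that
   became free to its mirror image. *)
Definition erase (n : nat) (D : diagram n) (E : {set 'I_n.*2 * 'I_n.*2}) :
    diagram n :=
  [ffun p => if [exists e in E, (p.2 == e.1) || (p.2 == e.2)]
             then mirror p else D p].

Definition Sset (n : nat) (D : diagram n) : {set diagram n} :=
  symTL n :&: [set erase D E | E in powerset (odd_edges D)].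

Definition black (n : nat) (I : {set 'I_n.*2}) (p : point n) : bool :=
  if p.1 then p.2 \notin I else p.2 \in I.

Definition compatible (n : nat) (I : {set 'I_n.*2}) : {set diagram n} :=
  [set D in symTL n | [forall p, black I p != black I (D p)]].

Definition is_Dmax (n : nat) (I : {set 'I_n.*2}) (D' Dm : diagram n) : bool :=
  [&& Dm \in symTL_even n :&: compatible I, D' \in Sset Dm
    & [forall D in compatible I, (D' \in Sset D) ==> (Sset D \subset Sset Dm)]].

Definition compatible_max (n : nat) (I : {set 'I_n.*2}) : {set diagram n} :=
  [set Dm | [exists D' in compatible I, is_Dmax I D' Dm]].

(* Encoding of nice embeddings.

   An edge (i, j') and its mirror image (j, i') meet at most once, and each
   meets the axis only where they meet each other.  So in a nice embedding the
   axis carries exactly n crossings, the unpaired ones; the left half consists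
   of 2n strands, the one from i and the one from pi(i) ending at the same
   point of the axis; and the right half is its mirror image.  Up to isotopy
   the left half is a wiring diagram.  It is encoded by the word w of its
   crossings from left to right: the letter k (with k + 1 < 2n) crosses the
   strands at heights k and k + 1, heights being counted from the top.  The
   strands that reach heights 2m and 2m + 1 then meet at the m-th point of
   the axis. *)

Definition swap_heights (k h : nat) : nat :=
  if h == k then k.+1 else if h == k.+1 then k else h.

(* Height of the strand starting at left vertex i after t crossings of w. *)
Definition height (w : seq nat) (t i : nat) : nat :=
  foldl (fun h k => swap_heights k h) i (take t w).

(* Number of times the strands from i and j cross in the left half. *)
Definition meets (w : seq nat) (i j : nat) : nat :=
  \sum_(t < size w)
     (perm_eq [:: height w t i; height w t j]
              [:: nth 0 w t; (nth 0 w t).+1] : nat).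

(* The edge from i to pi(i)' is the strand from i followed by the mirror image
   of the strand from pi(i).  In the last clause, the three summands count the
   meetings of the edges starting at i and j in the left half, in the right
   half, and on the axis. *)
Definition nice_embedding (n : nat) (pi : {ffun 'I_n.*2 -> 'I_n.*2})
    (w : seq nat) : Prop :=
  [/\ all (fun k => k.+1 < n.*2) w,
      forall i : 'I_n.*2,
        (height w (size w) i)./2 = (height w (size w) (pi i))./2
    & forall i j : 'I_n.*2, i != j ->
        meets w i j + meets w (pi i) (pi j) + (j == pi i) <= 1].

(* x.1 t: the t-th crossing of w and its mirror image are uncrossed vertically;
   x.2 m: the m-th crossing on the axis is uncrossed vertically.  The value
   false stands for horizontal. *)
Definition uncrossing (n : nat) (w : seq nat) : Type :=
  ({ffun 'I_(size w) -> bool} * {ffun 'I_n -> bool})%type.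

Section Uncrossing.
Variables (n : nat) (w : seq nat).

(* (t, (s, h)) is the point at height h after t crossings, counted from the left
   side (s = false) or from the right side (s = true) of the rectangle.
   Columns 0 are the two sides of the rectangle; columns size w are adjacent
   to the axis. *)
Definition node : Type := ('I_(size w).+1 * point n)%type.

Definition boundary (p : point n) : node := (ord0, p).

Definition mirror_node (u : node) : node := (u.1, mirror u.2).

Variable x : uncrossing n w.

(* The pieces of strands form a graph on the nodes; a vertical uncrossing joins
   the two nodes at heights k and k + 1 on each side of the crossing. *)
Definition step_link (u v : node) : bool :=
  (u.2.1 == v.2.1) &&
  [exists t : 'I_(size w),
     let k := nth 0 w t in
     if x.1 t && ((u.2.2 == k :> nat) || (u.2.2 == k.+1 :> nat))
     then [&& (u.1 == t :> nat) || (u.1 == t.+1 :> nat), v.1 == u.1,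
              u.2.2 == k :> nat & v.2.2 == k.+1 :> nat]
     else [&& u.1 == t :> nat, v.1 == t.+1 :> nat & v.2.2 == u.2.2]].

Definition axis_link (u v : node) : bool :=
  [&& u.1 == ord_max, v.1 == ord_max
    & [exists m : 'I_n,
         if x.2 m
         then [&& u.2.1 == v.2.1, u.2.2 == m.*2 :> nat
                & v.2.2 == m.*2.+1 :> nat]
         else [&& ~~ u.2.1, v.2.1, u.2.2./2 == m & v.2.2 == u.2.2]]].

Definition linked (u v : node) : bool :=
  [|| step_link u v, step_link v u, axis_link u v | axis_link v u].

(* The diagram D(x): each boundary point is joined to the other end of the
   strand through it. *)
Definition diagram_of : diagram n :=
  [ffun p => odflt p
     [pick q | (q != p) && connect linked (boundary p) (boundary q)]].

Definition component (u : node) : {set node} := [set v | connect linked u v].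

(* Every node off the boundary lies on exactly two pieces of strands, so a
   component that avoids the boundary is a closed loop. *)
Definition loops : {set {set node}} :=
  [set C in [set component u | u : node] | [forall p, boundary p \notin C]].

Definition nloops : nat :=
  #|[set C :|: [set mirror_node u | u in C] | C in loops]|.

Definition uv : nat := #|[set m | x.2 m]|.
Definition ph : nat := #|[set t | ~~ x.1 t]|.

Definition wt : int := (2 ^+ nloops * (-1) ^+ (uv + ph))%R.

End Uncrossing.

Section Pfaffinants.
Local Open Scope ring_scope.

Definition fcoef (n : nat) (w : seq nat) (D : diagram n) : int :=
  \sum_(x : uncrossing n w | diagram_of x == D) wt x.

Variables (R : comNzRingType) (n : nat).

(* emb pi is the chosen embedding of the matching nu(pi). *)
Variable emb : {ffun 'I_n.*2 -> 'I_n.*2} -> seq nat.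

Definition Pfaf' (D : diagram n) (A : 'M[R]_n.*2) : R :=
  \sum_(pi : {ffun 'I_n.*2 -> 'I_n.*2} | perfect_matching pi)
    (fcoef (emb pi) D)%:~R * match_weight A pi.

Definition Pfaf (D : diagram n) (A : 'M[R]_n.*2) : R :=
  \sum_(D' in Sset D) Pfaf' D' A.

End Pfaffinants.

(* Main.v *)
Require Import Defs.
From HB Require Import structures.
From mathcomp Require Import all_boot all_order all_algebra perm zify.
Set Implicit Arguments.
Unset Strict Implicit.
Unset Printing Implicit Defensive.
Import GRing.Theory.

(* Orient every strand of an uncrossing x, from black to white for the edges of
   D(x) and arbitrarily, but symmetrically, for the closed loops: the factor
   2^l(x) counts these orientations. The sum of wt over the x with D(x)
   I-compatible thus becomes a sum over local directions of the signs of the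
   consistent uncrossings, which factors over the crossings. A crossing of two
   strands with different directions that are not exchanged, and a crossing on
   the axis of two opposite strands, contribute -1 + 1 = 0. Only the directions
   carried along the strands survive; they agree on the axis iff pi preserves
   I, and the sign left over is that of the crossings between strands of equal color,
   which has the parity of the crossings of pi inside I and inside its
   complement. Hence pf_I pf_{~I} is the sum of Pfaf'_D over the I-compatible D.

   By parity, the odd edges that can be erased from a diagram without creating
   crossings become pairs of horizontal edges (h_1, h_2), (h_3, h_4), ...
   numbered from the top; so the largest diagram above a given compatible one
   joins all the pairs of this form whose ends have different colors. *)

(** * Paths and parities *)

(* A simple path from p to q uses up all the links at its vertices, so it
   fills the whole component. *)
Lemma connect_deg_le2 (T : finType) (e : rel T) (p q r : T) :
    symmetric e ->
    (forall u a b c, e u a -> e u b -> e u c -> [|| a == b, a == c | b == c]) ->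
    (forall a b, e p a -> e p b -> a = b) ->
    (forall a b, e q a -> e q b -> a = b) ->
    (forall a b, e r a -> e r b -> a = b) ->
    p != q -> connect e p q -> connect e p r -> (r == p) || (r == q).
Proof.
move=> sym_e deg2 degp degq degr npq /connectP[s ps def_q].
case/shortenP: ps def_q => {}s ps us _ def_q.
have size_s : 0 < size s.
  by case: s def_q {ps us} => [/= /eqP|//]; rewrite eq_sym (negbTE npq).
pose S := p :: s; pose v := nth p S.
have e_v i : i < size s -> e (v i) (v i.+1) by move=> lt_i; apply: (pathP p ps).
have v_inj i j : i <= size s -> j <= size s -> (v i == v j) = (i == j).
  by move=> le_i le_j; rewrite (nth_uniq p) //= ltnS.
have v_last : v (size s) = q by rewrite def_q (last_nth p).
have v_in i : i <= size s -> v i \in S by move=> le_i; rewrite mem_nth.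
(* The links of an inner vertex of the path are used up by its two neighbours on the path, and those
   of an end by its single one, so no link leaves the path. *)
have closedS u w : e u w -> (u \in S) = (w \in S).
  suff cl a b : e a b -> a \in S -> b \in S.
    by move=> e_uw; apply/idP/idP; apply: cl => //; rewrite sym_e.
  move=> e_ab /(nthP p)[i /=]; rewrite ltnS => le_i def_a; move: e_ab.
  rewrite -{}def_a -/(v i) => e_vb.
  have [i0|i_gt0] := posnP i.
    move: e_vb; rewrite i0 => /degp/(_ (e_v 0 size_s)) ->; exact: v_in.
  have e_prev : e (v i) (v i.-1) by rewrite sym_e -{2}(prednK i_gt0) e_v ?prednK.
  have [i_last|ni_last] := eqVneq i (size s).
    rewrite -(degq (v i.-1) b); first by apply: v_in; lia.
      by rewrite -v_last -i_last.
    by rewrite -v_last -i_last.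
  have lt_i : i < size s by rewrite ltn_neqAle ni_last.
  case/or3P: (deg2 _ _ _ _ e_vb e_prev (e_v i lt_i)) => /eqP; last 1 first.
  - by move/eqP; rewrite v_inj; [move/eqP; lia | lia | lia].
  - by move->; apply: v_in; lia.
  - by move->; apply: v_in; lia.
move=> p_r; have : r \in S.
  by rewrite -(closed_connect closedS p_r) mem_head.
case/(nthP p)=> i /=; rewrite ltnS => le_i def_r.
have [i0|i_gt0] := posnP i; first by rewrite -def_r i0 eqxx.
have [i_last|ni_last] := eqVneq i (size s).
  by rewrite -def_r i_last -/(v _) v_last eqxx orbT.
have lt_i : i < size s by rewrite ltn_neqAle ni_last.
(* An inner vertex has two distinct neighbours on the path, whereas all neighbours of [r]
   coincide. *)
have : v i.-1 = v i.+1.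
  apply: degr; rewrite -def_r -/(v i) ?e_v // sym_e -{2}(prednK i_gt0) e_v ?prednK //.
by move/eqP; rewrite v_inj; [move/eqP; lia | lia | lia].
Qed.

(** Applied with [f] marking the heights at which a component meets a column, this is the parity of
    the marks above height [h]. *)
Fixpoint prefix_parity (f : nat -> bool) (h : nat) : bool :=
  if h is h'.+1 then prefix_parity f h' (+) f h' else false.

Lemma eq_prefix_parity (f g : nat -> bool) h :
  (forall i, i < h -> f i = g i) -> prefix_parity f h = prefix_parity g h.
Proof.
elim: h => //= h IHh fg; rewrite fg // IHh // => i lt_i; apply: fg; lia.
Qed.

(** The equal values at [k] and [k + 1] cancel for [f] and for [g]; only a count stopping between
    them could tell the two apart. *)
Lemma prefix_parity_swap (f g : nat -> bool) k h :
    (forall i, i != k -> i != k.+1 -> f i = g i) -> f k = f k.+1 -> g k = g k.+1 ->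
  h != k.+1 -> prefix_parity f h = prefix_parity g h.
Proof.
move=> fg fk gk; have le_k i : i <= k -> prefix_parity f i = prefix_parity g i.
  by move=> le_i; apply: eq_prefix_parity => j lt_j; apply: fg; lia.
have [/le_k//|lt_kh] := leqP h k; move=> nh.
have {lt_kh nh} [d ->] : exists d, h = d + k.+2 by exists (h - k.+2); lia.
elim: d => [|d IHd]; last by rewrite addSn /= IHd fg //; lia.
by rewrite add0n /= fk gk le_k // -!addbA !addbb.
Qed.

Lemma prefix_parity_pairs (f g : nat -> bool) m :
    (forall i, i < m -> f i.*2 (+) f i.*2.+1 = g i.*2 (+) g i.*2.+1) ->
  prefix_parity f m.*2 = prefix_parity g m.*2.
Proof.
elim: m => //= m IHm fg; rewrite -!addbA fg // IHm // => i lt_i; apply: fg; lia.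
Qed.

Lemma prefix_parity_add (f g : nat -> bool) h :
  prefix_parity (fun i => f i (+) g i) h = prefix_parity f h (+) prefix_parity g h.
Proof. by elim: h => //= h ->; rewrite addbACA. Qed.

Lemma prefix_parity1 (b : bool) (a h : nat) :
  prefix_parity (fun i => b && (i == a)) h = b && (a < h).
Proof. by elim: h => [|h /= ->]; [rewrite andbF|lia]. Qed.

(** * Symmetric TL-diagrams *)

(** The points moved by [f] come in pairs: [f] exchanges those with [i < f i] and those with
    [f i < i]. *)
Lemma odd_card_involution n (S : {set 'I_n}) (f : 'I_n -> 'I_n) :
    (forall i, i \in S -> f i \in S) -> {in S, involutive f} ->
  odd #|S| = odd #|[set i in S | f i == i]|.
Proof.
move=> fS fK; pose L := [set i in S | i < f i]; pose G := [set i in S | f i < i].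
have -> : #|S| = #|[set i in S | f i == i]| + (#|L| + #|G|).
  have disjLG : [disjoint L & G].
    by rewrite -setI_eq0; apply/eqP/setP=> i; rewrite !inE; case: (i \in S) => //=; lia.
  rewrite -[#|L| + _]cardsUI (eqP (_ : L :&: G == set0)) ?setI_eq0 // cards0 addn0.
  rewrite -cardsUI (_ : [set i in S | f i == i] :&: (L :|: G) = set0) ?cards0 ?addn0.
    apply: eq_card => i; rewrite !inE -val_eqE /=.
    by case: (i \in S) => //=; case: ltngtP.
  by apply/setP=> i; rewrite !inE -val_eqE /=; case: (i \in S) => //=; case: ltngtP.
have -> : #|G| = #|L|.
  rewrite -(card_in_imset (f := f) (D := L)); last first.
    move=> i j; rewrite !inE => /andP[iS _] /andP[jS _] fij.
    by rewrite -(fK i iS) fij fK.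
  apply: eq_card => i; apply/idP/imsetP => [|[j]]; rewrite !inE => /andP[iS lt_i].
    by exists (f i); rewrite ?inE ?fS ?fK.
  by move=> ->; rewrite fS ?fK.
by rewrite addnn oddD odd_double addbF.
Qed.

Section SymTL.
Variables (n : nat) (D : diagram n).
Hypothesis D_sym : D \in symTL n.

Lemma symTL_neq p : D p != p.
Proof. by move: D_sym; rewrite inE => /and3P[/forallP/(_ p)/andP[]]. Qed.

Lemma symTL_invol p : D (D p) = p.
Proof. by move: D_sym; rewrite inE => /and3P[/forallP/(_ p)/andP[_ /eqP]]. Qed.

Lemma symTL_mirror p : D (mirror p) = mirror (D p).
Proof. by move: D_sym; rewrite inE => /and3P[_ _ /forallP/(_ p)/eqP]. Qed.

Lemma symTL_noncrossing p q :
  bpos p < bpos q -> bpos q < bpos (D p) -> ~~ (bpos (D p) < bpos (D q)).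
Proof.
move=> lt1 lt2; apply/negP=> lt3; move: D_sym; rewrite inE => /and3P[_ /eqP ncr _].
by have := in_set0 (p, q); rewrite -ncr inE /= lt1 lt2 lt3.
Qed.

(** An edge from [i] to a different height on the opposite side would cross its own mirror image. *)
Lemma symTL_across s i j : D (s, i) = (~~ s, j) -> j = i.
Proof.
wlog -> : s i j / s = false => [hw|].
  case: s => [Dij|/hw]; last exact.
  apply: (hw false i j) => //.
  by have := symTL_mirror (true, i); rewrite Dij.
move=> Dij; apply/eqP/negPn/negP; rewrite -val_eqE /= => nij.
have Dji : D (false, j) = (true, i).
  have Dtj : D (true, j) = (false, i) by rewrite -[(true, j)]Dij symTL_invol.
  by have := symTL_mirror (true, j); rewrite Dtj.
have li := ltn_ord i; have lj := ltn_ord j.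
have [lt_ij|lt_ji|//] := ltngtP i j; last by move=> eq_ij; rewrite eq_ij eqxx in nij.
  have := @symTL_noncrossing (false, i) (false, j).
  by rewrite Dij Dji /bpos /=; lia.
have := @symTL_noncrossing (false, j) (false, i).
by rewrite Dij Dji /bpos /=; lia.
Qed.

(* The partner of i on the left side; fixed points stand for the horizontal
   edges (i, i'). *)
Definition left_partner (i : 'I_n.*2) : 'I_n.*2 := (D (false, i)).2.

Lemma symTLE s i :
  D (s, i) = (if left_partner i == i then ~~ s else s, left_partner i).
Proof.
have Ds b : D (b, i) = (b (+) (D (false, i)).1, left_partner i).
  case: b; last by rewrite /left_partner addFb -surjective_pairing.
  by have := symTL_mirror (false, i); rewrite /mirror /= => ->.
have [fix_i|nfix] := eqVneq; last first.
  rewrite Ds; case E: (D (false, i)).1; last by rewrite addbF.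
  have /symTL_across ei : D (false, i) = (~~ false, left_partner i) by rewrite Ds E.
  by rewrite ei eqxx in nfix.
rewrite Ds; case E: (D (false, i)).1; first by rewrite addbT.
by have := symTL_neq (false, i); rewrite Ds E fix_i eqxx.
Qed.

Lemma left_partnerK : involutive left_partner.
Proof.
move=> i; have := symTL_invol (false, i); rewrite !symTLE /=.
by move=> /(congr1 snd).
Qed.

(** An edge starting under an arc of the left side cannot cross that arc, so it also ends under it
    and is not horizontal. *)
Lemma left_partner_between (i j : 'I_n.*2) :
    i < j -> j < left_partner i ->
  (i < left_partner j < left_partner i) && (left_partner j != j).
Proof.
move=> lt_ij lt_ji; have li := ltn_ord i; have lj := ltn_ord j.
have lpi := ltn_ord (left_partner i).
have ni : (left_partner i == i) = false by rewrite -val_eqE /=; lia.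
have := @symTL_noncrossing (false, i) (false, j).
have := @symTL_noncrossing (D (false, j)) (false, i).
rewrite symTL_invol !symTLE ni.
have [pj|npj] := eqVneq (left_partner j) j; rewrite /bpos /=; first by rewrite pj /=; lia.
have : left_partner j != left_partner i.
  by apply: contraFN ni => /eqP/(can_inj left_partnerK) ji; rewrite ji in lt_ij; lia.
have : left_partner j != i.
  by apply: contraTN lt_ji => /eqP <-; rewrite left_partnerK; lia.
by move: npj; rewrite -!val_eqE /=; lia.
Qed.

Lemma left_partner_outside (i j : 'I_n.*2) :
  left_partner j = j -> i < j -> left_partner i < j.
Proof.
move=> fj lt_ij; rewrite ltnNge; apply/negP=> le_j.
have nij : left_partner i != j.
  apply: contraTneq lt_ij => pj; suff <- : i = j by rewrite ltnn.
  by rewrite -(left_partnerK i) pj.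
have := @left_partner_between i j lt_ij; rewrite fj eqxx andbF; move: nij; rewrite -val_eqE /=; lia.
Qed.

Lemma odd_card_lt (m : nat) : m <= n.*2 -> odd #|[set i : 'I_n.*2 | i < m]| = odd m.
Proof.
move=> le_m; rewrite cardsE -sum1_card -[in RHS](card_ord m) -sum1_card.
by rewrite (big_ord_widen _ (fun=> 1) le_m).
Qed.

(* No edge leaves the set of points above a horizontal edge, nor the set of
   points under an arc. *)
Lemma horizontal_parity (i : 'I_n.*2) : left_partner i = i ->
  odd i = odd #|[set j : 'I_n.*2 | (j < i) && (left_partner j == j)]|.
Proof.
move=> fi; rewrite -odd_card_lt; last exact/ltnW/ltn_ord.
rewrite (odd_card_involution (f := left_partner)) => [| |j _]; last exact: left_partnerK.
  by congr (odd _); apply: eq_card => j; rewrite !inE.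
by move=> j; rewrite !inE; apply: left_partner_outside.
Qed.

Lemma arc_parity (i : 'I_n.*2) : i < left_partner i -> odd (left_partner i) = ~~ odd i.
Proof.
set j := left_partner i => lt_i; pose S := [set k : 'I_n.*2 | i < k < j].
have lj := ltn_ord j.
have: odd #|S| = false.
  rewrite (odd_card_involution (f := left_partner)) => [| |k _]; last exact: left_partnerK.
    rewrite (_ : [set _ in _ | _] = set0) ?cards0 //; apply/setP=> k; rewrite !inE.
    apply/negP=> /andP[/andP[lt_ik lt_kj] /eqP fk].
    have := left_partner_outside fk lt_ik; rewrite -/j; lia.
  by move=> k; rewrite !inE => /andP[lt_ik lt_kj]; case/andP: (left_partner_between lt_ik lt_kj).
(* The points before [j] are those strictly under the arc, even in number, and the first [i + 1]
   points. *)
have : odd (#|S| + #|[set k : 'I_n.*2 | k < i.+1]|) = odd j.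
  rewrite -cardsUI (_ : S :&: _ = set0); last by apply/setP=> k; rewrite !inE; lia.
  rewrite cards0 addn0 -(odd_card_lt (ltnW lj)); congr (odd _); apply: eq_card => k.
  by rewrite !inE; lia.
rewrite oddD odd_card_lt ?ltn_ord //.
by move=> <- -> /=.
Qed.

Lemma left_partner_parity (i : 'I_n.*2) :
  odd (left_partner i) = odd i (+) (left_partner i != i).
Proof.
have [->|] := eqVneq; first by rewrite addbF.
rewrite -val_eqE neq_ltn => /orP[] /= lt_i; rewrite addbT; last exact: arc_parity.
by have := @arc_parity (left_partner i); rewrite left_partnerK => ->; rewrite ?negbK.
Qed.

(** A horizontal edge always has ends of different colors, and reflection exchanges the colors, so
    only the left edges impose a condition. *)
Lemma compatibleP (I : {set 'I_n.*2}) :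
  reflect (forall i, left_partner i != i -> (left_partner i \in I) = (i \notin I))
          (D \in compatible I).
Proof.
rewrite inE D_sym /=; apply: (iffP forallP) => [bl i ni|bl [s i]].
  have := bl (false, i); rewrite symTLE (negbTE ni) /black /=.
  by case: (i \in I); case: (left_partner i \in I).
rewrite symTLE; have [->|/bl] := eqVneq (left_partner i) i.
  by rewrite /black; case: s; case: (i \in I).
by rewrite /black; case: s => /= ->; case: (i \in I).
Qed.

Lemma mem_left_edges e :
  (e \in left_edges D) = (e.1 < e.2) && (left_partner e.1 == e.2).
Proof.
rewrite inE symTLE xpair_eqE; have [->|] := eqVneq (left_partner e.1) e.1; last by [].
by rewrite /= -val_eqE /=; lia.
Qed.

End SymTL.

(** * Maximal compatible diagrams *)

(** Converse of [left_partner_between]: the condition on the left side alone rules out crossings all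
    around the boundary. *)
Lemma symTL_of_partner n (D : diagram n) (g : 'I_n.*2 -> 'I_n.*2) :
    (forall s i, D (s, i) = (if g i == i then ~~ s else s, g i)) ->
    involutive g ->
    (forall i j : 'I_n.*2, i < j -> j < g i -> (i < g j < g i) && (g j != j)) ->
  D \in symTL n.
Proof.
move=> Dg gK ncr; rewrite inE; apply/and3P; split.
- apply/forallP=> -[s i]; rewrite !Dg gK [i == g i]eq_sym !xpair_eqE.
  by case: (g i == i); case: s; rewrite ?eqxx ?andbF.
- apply/eqP/setP=> -[[s i] [s' j]]; rewrite !inE /= !Dg.
  apply/negP; rewrite /bpos /=.
  have li := ltn_ord i; have lj := ltn_ord j.
  have lgi := ltn_ord (g i); have lgj := ltn_ord (g j).
  (* The order along the boundary is reversed on the right side, so the hypothesis is taken for both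
     orders of the points and of their partners. *)
  have := ncr i j; have := ncr (g j) (g i); have := ncr j i; have := ncr (g i) (g j).
  rewrite !gK -!val_eqE /=; case: s; case: s' => /=;
    case: (eqVneq (g i : nat) i); case: (eqVneq (g j : nat) j) => /=; lia.
- by apply/forallP=> -[s i]; rewrite /mirror /= !Dg; case: (g i == i).
Qed.

Lemma Sset_refl n (D : diagram n) : D \in symTL n -> D \in Sset D.
Proof.
move=> D_sym; rewrite inE D_sym /=; apply/imsetP; exists set0.
  by rewrite inE sub0set.
by apply/ffunP=> p; rewrite ffunE; case: existsP => // -[e]; rewrite inE.
Qed.

Lemma Sset_trans n (D D1 D2 : diagram n) :
  D1 \in Sset D -> D2 \in Sset D1 -> D2 \in Sset D.
Proof.
rewrite !inE => /andP[_ /imsetP[E sE ->]] /andP[D2_sym /imsetP[F sF def_D2]].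
rewrite D2_sym /=; apply/imsetP; exists (E :|: F).
  move: sE sF; rewrite !inE subUset => -> /= /subsetP sF; apply/subsetP=> e /sF.
  rewrite !inE /erase ffunE => /andP[/andP[lt_e Ee] odd_e]; rewrite lt_e odd_e andbT /=.
  by move: Ee; case: ifP.
rewrite {}def_D2; apply/ffunP=> p; rewrite !ffunE.
case: existsP => [[e /andP[eF ep]]|nF].
  by case: existsP => // -[]; exists e; rewrite inE eF orbT.
case: existsP => [[e /andP[eE ep]]|nE]; case: existsP => //.
  by case; exists e; rewrite inE eE.
case=> e; rewrite inE => /andP[/orP[eE|eF] ep].
  by case: nE; exists e; rewrite eE.
by case: nF; exists e; rewrite eF.
Qed.

(** Erasing can only shrink the set of left edges, and an erasure that loses no left edge changes
    nothing. *)
Lemma Sset_antisym n (D D1 : diagram n) :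
  D1 \in Sset D -> D \in Sset D1 -> D1 = D.
Proof.
have le_edges (C C1 : diagram n) : C1 \in Sset C ->
    left_edges C1 \subset left_edges C /\ (left_edges C \subset left_edges C1 -> C1 = C).
  rewrite !inE => /andP[_ /imsetP[E]]; rewrite inE => /subsetP sE ->.
  have sub : left_edges (erase C E) \subset left_edges C.
    apply/subsetP=> e; rewrite !inE ffunE => /andP[-> /=].
    by case: ifP.
  split=> // /subsetP sub2; apply/ffunP=> p; rewrite ffunE.
  case: existsP => // -[e /andP[eE _]].
  have /sE := eE; rewrite inE => /andP[/sub2 e_in _]; move: e_in.
  rewrite !inE ffunE; case: existsP => [_|[]]; first by rewrite /mirror xpair_eqE andbF.
  by exists e; rewrite eE eqxx.
by move=> /le_edges[_ eqD] /le_edges[sub _]; apply: eqD.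
Qed.

Lemma Sset_compatible n (I : {set 'I_n.*2}) (D D1 : diagram n) :
  D \in compatible I -> D1 \in Sset D -> D1 \in compatible I.
Proof.
rewrite !inE => /andP[D_sym /forallP bl] /andP[D1_sym /imsetP[E _ def_D1]].
rewrite D1_sym; apply/forallP=> p; rewrite {}def_D1 ffunE; case: ifP => // _.
by rewrite /black /mirror /=; case: p.1; case: (p.2 \in I).
Qed.

Section MaximalDiagram.
Variables (n : nat) (I : {set 'I_n.*2}) (D0 : diagram n).
Hypothesis D0_compat : D0 \in compatible I.

Let D0_sym : D0 \in symTL n.
Proof. by move: D0_compat; rewrite inE => /andP[]. Qed.

Local Notation f := (left_partner D0).

(** There is exactly one more horizontal edge above [k] than above [i], and [horizontal_parity]
    identifies these counts with the parities of [k] and [i]. *)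
Lemma consecutive_parity (i k : 'I_n.*2) : i < k -> f i = i -> f k = k ->
  (forall j : 'I_n.*2, i < j < k -> f j != j) -> odd k = ~~ odd i.
Proof.
move=> lt_ik fi fk none; rewrite (horizontal_parity D0_sym fi) (horizontal_parity D0_sym fk).
rewrite (cardsD1 i) inE lt_ik fi eqxx /=; congr (~~ odd _); apply: eq_card => j.
rewrite !inE -val_eqE /=; have [fj|] := eqVneq (left_partner D0 j) j; last by rewrite !andbF.
by have := none j; rewrite fj eqxx; lia.
Qed.

(** These are the pairs (h_1, h_2), (h_3, h_4), ...: the horizontal edges alternate in parity from
    the top, starting with an even ordinal. *)
Definition consecutive (i j : 'I_n.*2) : bool :=
  [&& i < j, ~~ odd i, f i == i, f j == j & [forall k : 'I_n.*2, (i < k < j) ==> (f k != k)]].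

Lemma consecutiveP (i j : 'I_n.*2) : consecutive i j ->
  [/\ i < j, odd i = false, odd j, f i = i & f j = j /\
      forall k : 'I_n.*2, i < k < j -> f k != k].
Proof.
case/and5P=> lt_ij /negbTE ev_i /eqP fi /eqP fj /forallP none.
have {}none (k : 'I_n.*2) : i < k < j -> f k != k by apply/implyP/none.
by rewrite lt_ij ev_i (consecutive_parity lt_ij fi fj none) ev_i fi fj.
Qed.

(** An odd ordinal has an odd, hence positive, number of horizontal edges above it; an even one has
    another below it because the horizontal edges are even in number. *)
Lemma consecutive_ex i : f i = i -> exists j, consecutive i j || consecutive j i.
Proof.
move=> fi; have [odd_i|ev_i] := boolP (odd i).
  have [j0 j0P] : exists j : 'I_n.*2, (j < i) && (f j == j).
    have := horizontal_parity D0_sym fi; rewrite odd_i => /esym.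
    by case: (set_0Vmem [set j : 'I_n.*2 | (j < i) && (f j == j)]) => [->|[j]];
      rewrite ?cards0 // inE; exists j.
  case: (@arg_maxnP _ j0 (fun j => (j < i) && (f j == j)) (fun j : 'I_n.*2 => j : nat) j0P) => j /andP[lt_ji /eqP fj] max_j.
  have none (k : 'I_n.*2) : j < k < i -> f k != k.
    by move=> lt_k; apply/negP=> fk; have := max_j k; rewrite fk; lia.
  exists j; apply/orP; right; apply/and5P; split=> //; rewrite ?fi ?fj //; last first.
    by apply/forallP=> k; apply/implyP/none.
  by have := consecutive_parity lt_ji fj fi none; rewrite odd_i => <-.
have [j0 j0P] : exists j : 'I_n.*2, (i < j) && (f j == j).
  have [E|[j]] := set_0Vmem [set j : 'I_n.*2 | (i < j) && (f j == j)]; last first.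
    by rewrite inE; exists j.
  have : odd #|[set: 'I_n.*2]| = odd #|[set j in [set: 'I_n.*2] | f j == j]|.
    by apply: odd_card_involution => j _; [rewrite inE | apply: left_partnerK].
  rewrite cardsT card_ord odd_double (cardsD1 i) !inE fi eqxx add1n /=.
  suff -> : [set j in [set: 'I_n.*2] | f j == j] :\ i =
            [set j : 'I_n.*2 | (j < i) && (f j == j)].
    by rewrite -horizontal_parity // (negbTE ev_i).
  apply/setP=> j; rewrite !inE -val_eqE /=; have := in_set0 j; rewrite -E inE.
  by case: (f j == j); rewrite ?andbF //; lia.
case: (@arg_minnP _ j0 (fun j => (i < j) && (f j == j)) (fun j : 'I_n.*2 => j : nat) j0P) => j /andP[lt_ij /eqP fj] min_j.
exists j; apply/orP; left; apply/and5P; split=> //; rewrite ?fi ?fj //.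
apply/forallP=> k; apply/implyP=> lt_k.
by apply/negP=> fk; have := min_j k; rewrite fk; lia.
Qed.

Definition neighbour (i : 'I_n.*2) : 'I_n.*2 :=
  odflt i [pick j | consecutive i j || consecutive j i].

Lemma consecutive_inj i j k :
  consecutive i j -> consecutive i k || consecutive k i -> k = j.
Proof.
move=> /consecutiveP[lt_ij ev_i _ _ [fj none]].
case/orP=> /consecutiveP[lt_k _ odd_k _ [fk none']]; last by rewrite ev_i in odd_k.
apply/eqP; rewrite -val_eqE /=; case: ltngtP => // lt_jk.
  by have := none k; rewrite fk eqxx lt_k lt_jk => /(_ isT).
by have := none' j; rewrite fj eqxx lt_ij lt_jk => /(_ isT).
Qed.

Lemma consecutive_injr i j k :
  consecutive i j -> consecutive j k || consecutive k j -> k = i.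
Proof.
move=> /consecutiveP[lt_ij _ odd_j fi [_ none]].
case/orP=> /consecutiveP[lt_k ev_k _ fk [_ none']]; first by rewrite odd_j in ev_k.
apply/eqP; rewrite -val_eqE /=; case: ltngtP => // lt_jk.
  by have := none' i; rewrite fi eqxx lt_ij lt_jk => /(_ isT).
by have := none k; rewrite fk eqxx lt_k lt_jk => /(_ isT).
Qed.

Lemma consecutive_neighbour i j : consecutive i j -> neighbour i = j /\ neighbour j = i.
Proof.
move=> cij; rewrite /neighbour; split.
  case: pickP => [k ck|/(_ j)] /=; first exact: consecutive_inj cij ck.
  by rewrite cij.
case: pickP => [k ck|/(_ i)] /=; first exact: consecutive_injr cij ck.
by rewrite cij orbT.
Qed.

Lemma neighbourP i : f i = i -> consecutive i (neighbour i) || consecutive (neighbour i) i.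
Proof.
case/consecutive_ex=> j /orP[] cij; have [e1 e2] := consecutive_neighbour cij.
  by rewrite e1 cij.
by rewrite e2 cij orbT.
Qed.

Lemma neighbourK i : f i = i -> neighbour (neighbour i) = i.
Proof. by move=> fi; case/orP: (neighbourP fi) => /consecutive_neighbour[]. Qed.

Lemma neighbour_fix i : f i = i -> f (neighbour i) = neighbour i.
Proof. by move=> fi; case/orP: (neighbourP fi) => /consecutiveP[? ? ? ? []]. Qed.

Definition joined (i : 'I_n.*2) : bool :=
  (f i == i) && ((neighbour i \in I) != (i \in I)).

Definition max_partner (i : 'I_n.*2) : 'I_n.*2 := if joined i then neighbour i else f i.

Definition max_diagram : diagram n :=
  [ffun p => (if max_partner p.2 == p.2 then ~~ p.1 else p.1, max_partner p.2)].

Lemma joined_fix i : joined i -> f i = i.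
Proof. by case/andP=> /eqP. Qed.

Lemma joined_neighbour i : joined i -> joined (neighbour i).
Proof.
case/andP=> /eqP fi cij; rewrite /joined neighbour_fix // neighbourK // eqxx /=.
by rewrite eq_sym.
Qed.

Lemma max_partnerK : involutive max_partner.
Proof.
move=> i; rewrite {2}/max_partner; have [ji|nji] := boolP (joined i).
  by rewrite /max_partner joined_neighbour // neighbourK //; case/andP: ji => /eqP.
rewrite /max_partner; case: ifP => [jfi|_]; last exact: left_partnerK.
have fi : f i = i by apply: (can_inj (left_partnerK D0_sym)); apply: joined_fix.
by rewrite fi (negbTE nji) in jfi.
Qed.

Lemma max_diagramE s i :
  max_diagram (s, i) = (if max_partner i == i then ~~ s else s, max_partner i).
Proof. by rewrite ffunE. Qed.

Lemma joined_neq i : joined i -> neighbour i != i.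
Proof. by case/andP=> _; apply: contraNneq => ->. Qed.

(** No old arc covers a horizontal edge, and the points between two consecutive horizontal edges are
    matched among themselves, so the new arcs cross nothing. *)
Lemma max_diagram_sym : max_diagram \in symTL n.
Proof.
apply: symTL_of_partner max_diagramE max_partnerK _ => i j lt_ij.
have [ji|nji] := boolP (joined i); last first.
  rewrite [max_partner i](ifN _ _ nji) => lt_ji.
  have [between nfj] := andP (left_partner_between D0_sym lt_ij lt_ji).
  by rewrite /max_partner /joined (negbTE nfj) /= between nfj.
rewrite [max_partner i](ifT _ _ ji) => lt_ji.
have fi := joined_fix ji; have fn := neighbour_fix fi.
case/orP: (neighbourP fi) => /consecutiveP[lt_i _ _ _ [_ none]]; last by lia.
have nfj : f j != j by apply: none; rewrite lt_ij.
rewrite /max_partner /joined (negbTE nfj) /= nfj andbT.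
have := @left_partner_outside _ _ D0_sym (f j) i fi.
have := @left_partner_outside _ _ D0_sym (f j) _ fn.
have := @left_partner_outside _ _ D0_sym j _ fn lt_ji.
rewrite left_partnerK // => lt1 _ lt2.
have : f j != i.
  apply: contraNneq nfj => fji.
  by rewrite -[X in _ == X](left_partnerK D0_sym) fji fi.
rewrite -val_eqE /=; lia.
Qed.

Lemma max_partner_neq i :
  (max_partner i == i) = (f i == i) && ((neighbour i \in I) == (i \in I)).
Proof.
rewrite /max_partner; have [ji|nji] := boolP (joined i).
  by rewrite (negbTE (joined_neq ji)); move: ji; rewrite /joined; case: eqP => //= _ /negbTE ->.
by move: nji; rewrite /joined; case: eqP => //= _ /negPn ->.
Qed.

Lemma left_partner_max i : left_partner max_diagram i = max_partner i.
Proof. by rewrite /left_partner max_diagramE. Qed.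

Lemma max_diagram_compatible : max_diagram \in compatible I.
Proof.
apply/(compatibleP max_diagram_sym) => i; rewrite left_partner_max max_partner_neq.
rewrite /max_partner /joined; case: eqP => [_|/eqP nfi _] /=.
  by move=> neq; rewrite neq; move: neq; case: (i \in I); case: (_ \in I).
by apply: (compatibleP D0_sym I D0_compat).
Qed.

Lemma max_diagram_Sset : D0 \in Sset max_diagram.
Proof.
rewrite inE D0_sym /=; apply/imsetP.
(* Exactly the new edges are erased; their upper ends are even ordinals, which makes them odd
   edges. *)
exists [set e | [&& consecutive e.1 e.2, joined e.1 & joined e.2]].
  rewrite inE; apply/subsetP=> e; rewrite !inE => /and3P[ce je _].
  have [lt_e ev_e _ _ _] := consecutiveP ce; rewrite lt_e ev_e andbT /=.
  rewrite max_diagramE max_partner_neq /max_partner je.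
  move: je => /andP[_ /negbTE ->]; rewrite andbF.
  by have [-> _] := consecutive_neighbour ce.
apply/ffunP=> -[s i]; rewrite [RHS]ffunE /=; case: existsP => [[e /andP[]]|nE].
  rewrite inE => /and3P[_ je1 je2] ie; have fi : f i = i.
    by case/orP: ie => /eqP ->; apply: joined_fix.
  by rewrite symTLE // fi eqxx.
have [ji|nji] := boolP (joined i); last first.
  by rewrite max_diagramE symTLE // /max_partner (negbTE nji).
case: nE; have jn := joined_neighbour ji.
case/orP: (neighbourP (joined_fix ji)) => ci.
  by exists (i, neighbour i); rewrite inE /= ci ji jn eqxx.
by exists (neighbour i, i); rewrite inE /= ci ji jn eqxx orbT.
Qed.

(** Each edge erased from [D] to give [D0] joins a consecutive pair with ends of different colors,
    so [max_diagram] has it too. Erasing from [max_diagram] the joined pairs that are horizontal in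
    [D] then gives [D]. *)
Lemma max_diagram_maximal D : D \in compatible I -> D0 \in Sset D -> D \in Sset max_diagram.
Proof.
move=> D_compat; have D_sym : D \in symTL n by move: D_compat; rewrite inE => /andP[].
rewrite inE D0_sym /= => /imsetP[E]; rewrite inE => /subsetP sE def_D0.
have edgeE e : e \in E ->
    [/\ e.1 < e.2, odd e.1 = false, left_partner D e.1 = e.2, f e.1 = e.1 & f e.2 = e.2].
  move=> eE; have := sE e eE; rewrite inE mem_left_edges // => /andP[/andP[lt_e /eqP De] /negbTE ev_e].
  rewrite lt_e ev_e De /left_partner def_D0 !ffunE /=.
  by rewrite !ifT //; apply/existsP; exists e; rewrite eE eqxx ?orbT.
have fE i : f i = i -> left_partner D i != i -> exists2 e, e \in E & (i == e.1) || (i == e.2).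
  rewrite {1}/left_partner def_D0 ffunE; case: existsP => [[e /andP[]]|_]; last first.
    by rewrite -/(left_partner D i) => ->; rewrite eqxx.
  by exists e.
(* Otherwise take the topmost horizontal point [k] of [D0] between the ends of [e]. It is an odd
   ordinal, hence the lower end of another erased edge, whose upper end is a still higher horizontal
   point between them. *)
have consE e : e \in E -> consecutive e.1 e.2.
  move=> eE; have [lt_e ev_e De fe1 fe2] := edgeE e eE.
  apply/and5P; split; rewrite ?fe1 ?fe2 ?ev_e //; apply/negPn/negP.
  rewrite negb_forall => /existsP[k0 k0P].
  have {}k0P : (e.1 < k0 < e.2) && (f k0 == k0) by move: k0P; rewrite negb_imply negbK.
  case: (@arg_minnP _ k0 (fun k : 'I_n.*2 => (e.1 < k < e.2) && (f k == k)) (fun j : 'I_n.*2 => j : nat) k0P).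
  move=> k /andP[/andP[lt_k1 lt_k2] /eqP fk] min_k.
  have [/andP[lt_Dk1 lt_Dk2] nDk] : (e.1 < left_partner D k < e.2) /\ left_partner D k != k.
    by apply/andP; have := @left_partner_between _ _ D_sym e.1 k lt_k1; rewrite De; apply.
  have odd_k : odd k.
    rewrite (consecutive_parity lt_k1 fe1 fk) ?ev_e // => j lt_j.
    by apply/negP=> fj; have := min_k j; rewrite fj; lia.
  have [e' e'E ke'] := fE k fk nDk.
  have [lt_e' ev_e' De' fe1' _] := edgeE e' e'E.
  case/orP: ke' => /eqP ke'; first by rewrite ke' ev_e' in odd_k.
  have eq_Dk : left_partner D k = e'.1 by rewrite ke' -De' left_partnerK.
  by have := min_k e'.1; rewrite fe1' eqxx -eq_Dk; move: lt_e'; rewrite -eq_Dk -ke'; lia.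
have joinE i : f i = i -> left_partner D i != i -> joined i /\ left_partner D i = neighbour i.
  move=> fi nDi; have [e eE ie] := fE i fi nDi.
  have [_ _ De _ _] := edgeE e eE; have [n1 n2] := consecutive_neighbour (consE e eE).
  have Dn : left_partner D i = neighbour i.
    by case/orP: ie => /eqP ->; rewrite ?n1 ?n2 // -De left_partnerK.
  split=> //; rewrite /joined fi eqxx -Dn /= (compatibleP D_sym I D_compat) //.
  by case: (i \in I).
have outE i : left_partner D i = i -> f i = i.
  move=> Di; rewrite /left_partner def_D0 ffunE; case: ifP => //.
have Df i : f i != i -> left_partner D i = f i.
  move=> nfi; move: (nfi); rewrite /left_partner def_D0 ffunE; case: ifP => //=.
  by rewrite eqxx.
rewrite inE D_sym /=; apply/imsetP.
exists [set e | [&& consecutive e.1 e.2, joined e.1, joined e.2 & left_partner D e.1 == e.1]].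
  rewrite inE; apply/subsetP=> e; rewrite !inE => /and4P[ce je _ _].
  have [lt_e ev_e _ _ _] := consecutiveP ce; rewrite lt_e ev_e andbT /=.
  rewrite max_diagramE max_partner_neq /max_partner je.
  move: je => /andP[_ /negbTE ->]; rewrite andbF.
  by have [-> _] := consecutive_neighbour ce.
apply/ffunP=> -[s i]; rewrite [RHS]ffunE /= symTLE //; case: existsP => [[e /andP[]]|nE].
  rewrite inE => /and4P[ce je1 je2 /eqP De1] ie.
  suff -> : left_partner D i = i by rewrite eqxx.
  have [n1 n2] := consecutive_neighbour ce.
  case/orP: ie => /eqP -> //; apply/eqP/negPn/negP => nDe2.
  have [_] := joinE _ (joined_fix je2) nDe2; rewrite n2 => De2.
  have e21 : e.2 = e.1 by rewrite -(left_partnerK D_sym e.2) De2 De1.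
  by rewrite e21 De1 eqxx in nDe2.
rewrite max_diagramE; suff -> : max_partner i = left_partner D i by [].
have [fi|nfi] := eqVneq (f i) i; last by rewrite Df // /max_partner /joined (negbTE nfi).
have [Di|nDi] := eqVneq (left_partner D i) i; last first.
  by have [ji Dn] := joinE i fi nDi; rewrite /max_partner ji.
rewrite Di; have [ji|nji] := boolP (joined i); last by rewrite /max_partner (negbTE nji).
have jn := joined_neighbour ji.
have Dn : left_partner D (neighbour i) = neighbour i.
  apply/eqP/negPn/negP => nDn; have [_] := joinE _ (joined_fix jn) nDn.
  rewrite neighbourK // => Dn.
  have ni : neighbour i = i by rewrite -(left_partnerK D_sym (neighbour i)) Dn Di.
  by rewrite ni Di eqxx in nDn.
case: nE; case/orP: (neighbourP fi) => ci.
  by exists (i, neighbour i); rewrite inE /= ci ji jn Di !eqxx.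
by exists (neighbour i, i); rewrite inE /= ci ji jn Dn !eqxx orbT.
Qed.

(** Each left edge has exactly one end in [I], and the horizontal points of [max_diagram] in [I]
    pair off with their neighbours, so the order has the parity of [#|I|]. *)
Lemma max_diagram_even : ~~ odd #|I| -> max_diagram \in symTL_even n.
Proof.
rewrite inE max_diagram_sym /= -(cardsID [set i | max_partner i == i]) oddD.
suff -> : odd #|I :&: [set i | max_partner i == i]| = false.
  suff -> : #|I :\: [set i | max_partner i == i]| = order_TL max_diagram by [].
  pose edge (i : 'I_n.*2) := if i < max_partner i then (i, max_partner i) else (max_partner i, i).
  rewrite -(card_in_imset (f := edge)) => [|i j].
    apply: eq_card => -[a b]; rewrite mem_left_edges ?max_diagram_sym // left_partner_max /=.
    apply/imsetP/andP => [[i]|[lt_ab /eqP ab]].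
      rewrite !inE -val_eqE /edge neq_ltn => /andP[lt_i iI].
      case: ifP lt_i => /= [lt_i _ [-> ->]|_]; first by rewrite lt_i.
      by rewrite orbF => lt_i [-> ->]; rewrite lt_i max_partnerK.
    have ba : max_partner b = a by rewrite -ab max_partnerK.
    have := compatibleP max_diagram_sym I max_diagram_compatible a.
    rewrite left_partner_max ab -val_eqE gtn_eqF //= => /(_ isT) bI.
    have [aI|aI] := boolP (a \in I).
      exists a; last by rewrite /edge ab lt_ab.
      by rewrite !inE aI ab -val_eqE gtn_eqF.
    exists b; last by rewrite /edge ba ltnNge ltnW.
    by rewrite !inE bI ba aI -val_eqE ltn_eqF.
  rewrite !inE => /andP[nfi iI] /andP[nfj jI].
  have := compatibleP max_diagram_sym I max_diagram_compatible i.
  rewrite left_partner_max => /(_ nfi); rewrite iI => gi.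
  have := compatibleP max_diagram_sym I max_diagram_compatible j.
  rewrite left_partner_max => /(_ nfj); rewrite jI => gj.
  rewrite /edge; case: ifP => _; case: ifP => _ [] // => eij e'ij.
    by rewrite eij gj in iI.
  by rewrite e'ij gj in iI.
(* Two neighbours that stay horizontal have the same color, so [neighbour] acts on this set, without
   fixed points. *)
rewrite (odd_card_involution (f := neighbour)) => [|i|i].
- apply/eqP; rewrite -[_ == _]negbK eqbF_neg negbK; apply/eqP.
  rewrite (_ : [set _ in _ | _] = set0) ?cards0 //; apply/setP=> i; rewrite !inE max_partner_neq.
  apply/negP=> /andP[/and3P[_ /eqP fi _] /eqP ni].
  by case/orP: (neighbourP fi); rewrite ni => /consecutiveP[]; rewrite ltnn.
- rewrite !inE !max_partner_neq => /and3P[iI /eqP fi /eqP ni].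
  by rewrite neighbour_fix // neighbourK // ni iI !eqxx.
- by rewrite !inE max_partner_neq => /and3P[_ /eqP fi _]; apply: neighbourK.
Qed.

End MaximalDiagram.

Lemma max_diagram_is_Dmax n (I : {set 'I_n.*2}) (D : diagram n) :
  ~~ odd #|I| -> D \in compatible I -> is_Dmax I D (max_diagram I D).
Proof.
move=> I_even DI; apply/and3P; split.
- by rewrite inE max_diagram_even // max_diagram_compatible.
- exact: max_diagram_Sset.
apply/forallP=> D1; apply/implyP=> D1I; apply/implyP=> D_D1; apply/subsetP=> D2.
by apply: Sset_trans; apply: max_diagram_maximal.
Qed.

(** [Sset Dm] is the fibre of [max_diagram I] over [Dm], so these sets partition the compatible
    diagrams. The two diagrams [Dm] and [max_diagram I D] lie in each other's [Sset] by their
    maximality. *)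
Lemma Sset_compatible_max n (I : {set 'I_n.*2}) (Dm D : diagram n) :
    ~~ odd #|I| -> Dm \in compatible_max I ->
  (D \in Sset Dm) = (D \in compatible I) && (max_diagram I D == Dm).
Proof.
move=> I_even; rewrite inE => /existsP[D' /and4P[D'I /setIP[_ DmI] D'_Dm max_Dm]].
apply/idP/andP=> [D_Dm|[DI /eqP <-]]; last exact: max_diagram_Sset.
have DI := Sset_compatible DmI D_Dm; split=> //.
have Dm_max := max_diagram_maximal DI DmI D_Dm.
have maxI := max_diagram_compatible DI.
apply/eqP/(Sset_antisym _ Dm_max).
move/forallP: max_Dm => /(_ (max_diagram I D)).
rewrite maxI (Sset_trans Dm_max D'_Dm) /= => /subsetP; apply.
by apply: Sset_refl; apply: max_diagram_sym.
Qed.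

Lemma sum_compatible_max (V : nmodType) n (I : {set 'I_n.*2}) (F : diagram n -> V) :
    ~~ odd #|I| ->
  (\sum_(Dm in compatible_max I) \sum_(D in Sset Dm) F D =
   \sum_(D in compatible I) F D)%R.
Proof.
move=> I_even.
rewrite [RHS](partition_big (max_diagram I) (mem (compatible_max I))) => [|D DI] /=.
  by apply: eq_bigr => Dm DmI; apply: eq_bigl => D; rewrite (Sset_compatible_max D I_even DmI).
by rewrite inE; apply/existsP; exists D; rewrite DI max_diagram_is_Dmax.
Qed.

(** * The strands of an uncrossing *)

Lemma mirrorK n : involutive (@mirror n).
Proof. by case=> s i; rewrite /mirror negbK. Qed.

Lemma mirror_nodeK n w : involutive (@mirror_node n w).
Proof. by case=> t p; rewrite /mirror_node /= mirrorK. Qed.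

(** Local form, at one crossing, of being constant along the strands: [c] and [c'] are the values in
    the columns before and after it, and [b] marks a vertical uncrossing. [axis_ok] does the same on
    the axis. *)
Definition step_ok (N k : nat) (b : bool) (c c' : 'I_N -> bool) : bool :=
  [forall h : 'I_N, if b && ((h == k :> nat) || (h == k.+1 :> nat))
     then [forall h' : 'I_N, (h == k :> nat) && (h' == k.+1 :> nat) ==>
                             (c h == c h') && (c' h == c' h')]
     else c h == c' h].

Definition axis_ok (N m : nat) (b : bool) (c c' : 'I_N -> bool) : bool :=
  if b then [forall h : 'I_N, forall h' : 'I_N,
               (h == m.*2 :> nat) && (h' == m.*2.+1 :> nat) ==>
               (c h == c h') && (c' h == c' h')]
  else [forall h : 'I_N, (h./2 == m) ==> (c h == c' h)].

Section Links.
Variables (n : nat) (w : seq nat) (x : uncrossing n w).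

Definition col_left (t : 'I_(size w)) : 'I_(size w).+1 := widen_ord (leqnSn _) t.
Definition col_right (t : 'I_(size w)) : 'I_(size w).+1 := lift ord0 t.
Definition column (e : node n w -> bool) t s (h : 'I_n.*2) : bool := e (t, (s, h)).

Lemma linked_sym : symmetric (linked x).
Proof.
move=> u v; rewrite /linked.
by case: (step_link x u v); case: (step_link x v u); rewrite ?orbT //= orbC.
Qed.

(** Constancy along the strands splits into one condition per crossing, which later turns a sum over
    uncrossings into a product. *)
Lemma linked_constP (e : node n w -> bool) :
  (forall u v, linked x u v -> e u = e v) <->
  (forall (t : 'I_(size w)) s, step_ok (nth 0 w t) (x.1 t) (column e (col_left t) s) (column e (col_right t) s)) /\
  (forall m : 'I_n, axis_ok m (x.2 m) (column e ord_max false) (column e ord_max true)).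
Proof.
split=> [e_const|[step axis]].
  have e_step u v : step_link x u v -> e u = e v by move=> uv; apply: e_const; rewrite /linked uv.
  have e_axis u v : axis_link x u v -> e u = e v.
    by move=> uv; apply: e_const; rewrite /linked uv !orbT.
  split=> [t s|m].
    apply/forallP=> h; case: ifP => [/andP[xt hk]|nv].
      apply/forallP=> h'; apply/implyP=> /andP[hk1 hk2].
      by apply/andP; split; apply/eqP/e_step; rewrite /step_link /= eqxx /=;
        apply/existsP; exists t; rewrite xt hk1 hk2 /bump /= !eqxx ?orbT.
    apply/eqP/e_step; rewrite /step_link /= eqxx; apply/existsP; exists t.
    by rewrite nv /= ?eqxx.
  rewrite /axis_ok; case: ifP => xm.
    apply/forallP=> h; apply/forallP=> h'; apply/implyP=> /andP[hk1 hk2].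
    by apply/andP; split; apply/eqP/e_axis; rewrite /axis_link /= !eqxx /=;
      apply/existsP; exists m; rewrite xm hk1 hk2 ?eqxx.
  apply/forallP=> h; apply/implyP=> hm; apply/eqP/e_axis; rewrite /axis_link /= !eqxx /=.
  by apply/existsP; exists m; rewrite xm hm ?eqxx.
have e_step u v : step_link x u v -> e u = e v.
  case: u v => [t1 [s h]] [t2 [s' h']] /andP[/= /eqP <- /existsP[t]].
  have := step t s => /forallP/(_ h) st; case: ifP st => _.
    move=> /forallP/(_ h')/implyP + /and4P[ht1 /eqP -> hk hk'].
    rewrite hk hk' => /(_ isT)/andP[/eqP eL /eqP eR].
    by case/orP: ht1 => /eqP ht1; [have -> : t1 = col_left t | have -> : t1 = col_right t] => //;
      apply: ord_inj.
  move=> /eqP + /and3P[/eqP ht1 /eqP ht2 /eqP ->].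
  by have -> : t1 = col_left t; [apply: ord_inj | have -> : t2 = col_right t; [apply: ord_inj|]].
have e_axis u v : axis_link x u v -> e u = e v.
  case: u v => [t1 [s h]] [t2 [s' h']] /and3P[/= /eqP -> /eqP -> /existsP[m]].
  have := axis m; rewrite /axis_ok; case: ifP => _.
    move=> /forallP/(_ h)/forallP/(_ h')/implyP + /and3P[/eqP <- h1 h2].
    by rewrite h1 h2 => /(_ isT)/andP[/eqP e1 /eqP e2]; case: s.
  move=> /forallP/(_ h)/implyP + /and4P[/negbTE -> -> hm /eqP ->].
  by move=> /(_ hm)/eqP.
by move=> u v /or4P[/e_step|/e_step|/e_axis|/e_axis].
Qed.

(** Natural numbers replace ordinals so that neighbours can be written without range proofs. *)
Definition node_code (u : node n w) : nat * bool * nat := (u.1 : nat, u.2.1, u.2.2 : nat).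

Lemma node_code_inj : injective node_code.
Proof. by case=> [t [s h]] [t' [s' h']] [/ord_inj -> -> /ord_inj ->]. Qed.

Definition turns (t h : nat) : bool :=
  [exists t' : 'I_(size w), (t' == t :> nat) && x.1 t'] &&
  ((h == nth 0 w t) || (h == (nth 0 w t).+1)).

(** A node has at most one link towards the axis and, outside column 0, at most one towards the
    sides. Hence the degree is at most two, and at most one on the boundary. *)
Definition inner_neighbour (u : node n w) : nat * bool * nat :=
  let: (t, (s, h)) := u in
  if t < size w then
    if turns t h then (t : nat, s, swap_heights (nth 0 w t) h) else (t.+1, s, h : nat)
  else if [exists m : 'I_n, (m == h./2 :> nat) && x.2 m]
    then (t : nat, s, swap_heights h./2.*2 h) else (t : nat, ~~ s, h : nat).

Definition outer_neighbour (u : node n w) : nat * bool * nat :=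
  let: (t, (s, h)) := u in
  if turns t.-1 h then (t : nat, s, swap_heights (nth 0 w t.-1) h) else (t.-1, s, h : nat).

Lemma turnsE (t : 'I_(size w)) (h : nat) :
  turns t h = x.1 t && ((h == nth 0 w t) || (h == (nth 0 w t).+1)).
Proof.
rewrite /turns; congr (_ && _); apply/existsP/idP => [[t' /andP[/eqP/ord_inj ->]]//|xt].
by exists t; rewrite eqxx.
Qed.

Lemma linked_neighbours u v : linked x u v ->
  node_code v = inner_neighbour u \/ (0 < u.1 /\ node_code v = outer_neighbour u).
Proof.
case: u v => [t1 [s h]] [t2 [s' h']].
rewrite /linked /step_link /axis_link /node_code /inner_neighbour /outer_neighbour /=.
case/or4P.
- case/andP=> /eqP <- /existsP[t]; case: ifP => xt.
    case/and4P=> ht1 /eqP -> /eqP hk /eqP ->; rewrite hk.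
    have tk : turns t (nth 0 w t) by move: xt; rewrite turnsE => /andP[-> _]; rewrite eqxx.
    have sw : swap_heights (nth 0 w t) (nth 0 w t) = (nth 0 w t).+1.
      by rewrite /swap_heights eqxx.
    by case/orP: ht1 => /eqP ->; rewrite ?ltn_ord /= tk sw; [left|right].
  by case/and3P=> /eqP -> /eqP -> /eqP ->; rewrite ltn_ord turnsE xt; left.
- case/andP=> /eqP <- /existsP[t]; case: ifP => xt.
    case/and4P=> ht1 /eqP -> /eqP hk /eqP ->; rewrite hk.
    have tk : turns t (nth 0 w t).+1 by move: xt; rewrite turnsE => /andP[-> _]; rewrite eqxx orbT.
    have sw : swap_heights (nth 0 w t) (nth 0 w t).+1 = nth 0 w t.
      by rewrite /swap_heights eqxx gtn_eqF.
    by case/orP: ht1 => /eqP ->; rewrite ?ltn_ord /= tk sw; [left|right].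
  by case/and3P=> /eqP -> /eqP -> /eqP ->; rewrite /= turnsE xt; right.
- case/and3P=> /eqP -> /eqP -> /existsP[m]; rewrite /= ltnn; case: ifP => xm.
    case/and3P=> /eqP <- /eqP -> /eqP ->; rewrite doubleK ifT.
      by rewrite /swap_heights eqxx; left.
    by apply/existsP; exists m; rewrite eqxx.
  case/and4P=> /negbTE -> -> /eqP hm /eqP ->; rewrite ifF; first by left.
  by apply/existsP=> -[m' /andP[/eqP]]; rewrite hm => /ord_inj ->; rewrite xm.
- case/and3P=> /eqP -> /eqP -> /existsP[m]; rewrite /= ltnn; case: ifP => xm.
    case/and3P=> /eqP <- /eqP -> /eqP ->; rewrite /= uphalf_double ifT.
      by rewrite /swap_heights eqxx gtn_eqF //; left.
    by apply/existsP; exists m; rewrite eqxx.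
  case/and4P=> /negbTE -> -> /eqP hm /eqP ->; rewrite ifF; first by left.
  by apply/existsP=> -[m' /andP[/eqP]]; rewrite hm => /ord_inj ->; rewrite xm.
Qed.

Lemma linked_deg2 u a b c : linked x u a -> linked x u b -> linked x u c ->
  [|| a == b, a == c | b == c].
Proof.
move=> /linked_neighbours ca /linked_neighbours cb /linked_neighbours cc.
have codeE y z : node_code y = node_code z -> y == z by move/node_code_inj/eqP.
case: ca => [|[_]] ca; case: cb => [|[_]] cb; case: cc => [|[_]] cc; apply/or3P;
  by [ apply/Or31/codeE; rewrite ca cb | apply/Or32/codeE; rewrite ca cc
     | apply/Or33/codeE; rewrite cb cc].
Qed.

Lemma linked_boundary p a b :
  linked x (boundary w p) a -> linked x (boundary w p) b -> a = b.
Proof.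
move=> /linked_neighbours[ca|[]//] /linked_neighbours[cb|[]//].
by apply: node_code_inj; rewrite ca cb.
Qed.

Lemma linked_mirror u v : linked x (mirror_node u) (mirror_node v) = linked x u v.
Proof.
have stepE a b : step_link x (mirror_node a) (mirror_node b) = step_link x a b.
  by rewrite /step_link /= (inj_eq negb_inj).
(* A horizontal link on the axis is listed from left to right only, so its mirror image appears with
   its ends exchanged. *)
have axisE a b : axis_link x a b -> axis_link x (mirror_node a) (mirror_node b) ||
                                     axis_link x (mirror_node b) (mirror_node a).
  case/and3P=> a1 b1 /existsP[m ab].
  have [xm|xm] := boolP (x.2 m); apply/orP; [left|right]; apply/and3P; split=> //;
    apply/existsP; exists m; move: ab; rewrite ?xm ?(negbTE xm) /= ?(inj_eq negb_inj) //.
  by case/and4P=> -> -> /eqP hm /eqP ba; rewrite ba hm !eqxx.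
have half a b : linked x a b -> linked x (mirror_node a) (mirror_node b).
  rewrite /linked !stepE => /or4P[->//|->|/axisE|/axisE]; rewrite ?orbT //.
    by case/orP=> ->; rewrite !orbT.
  by case/orP=> ->; rewrite !orbT.
by apply/idP/idP => /half //; rewrite !mirror_nodeK.
Qed.

Lemma connect_linked_sym : connect_sym (linked x).
Proof. exact: sym_connect_sym linked_sym. Qed.

Lemma connect_mirror u v :
  connect (linked x) (mirror_node u) (mirror_node v) = connect (linked x) u v.
Proof.
have half a b : connect (linked x) a b -> connect (linked x) (mirror_node a) (mirror_node b).
  case/connectP=> p; elim: p a => [a _ ->//|c p IHp a] /= /andP[ac cp] def_b.
  by apply: connect_trans (IHp c cp def_b); rewrite connect1 ?linked_mirror.
by apply/idP/idP => /half //; rewrite !mirror_nodeK.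
Qed.

End Links.

(** * The diagram of an uncrossing is a symmetric TL-diagram *)

Section DiagramOf.
Variables (n : nat) (w : seq nat) (x : uncrossing n w).
Hypothesis w_ok : all (fun k => k.+1 < n.*2) w.

Notation linked_const e := (forall u v, linked x u v -> e u = e v).

Lemma linked_const_connect (T : Type) (e : node n w -> T) : linked_const e ->
  forall u v, connect (linked x) u v -> e u = e v.
Proof.
move=> e_const u v /connectP[p]; elim: p u => [u _ -> //|c p IHp u] /= /andP[uc cp] def_v.
by rewrite (e_const _ _ uc) (IHp c).
Qed.

Lemma letter_lt (t : 'I_(size w)) : (nth 0 w t).+1 < n.*2.
Proof. by apply: (allP w_ok); apply: mem_nth. Qed.

(** Extended by [false] beyond the last height, so that prefixes of a column are counted over
    natural numbers. *)
Definition colnat (e : node n w -> bool) t s (h : nat) : bool :=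
  [exists h' : 'I_n.*2, (h' == h :> nat) && e (t, (s, h'))].

Lemma colnatE e t s (h : 'I_n.*2) : colnat e t s h = e (t, (s, h)).
Proof.
apply/existsP/idP => [[h' /andP[/eqP/ord_inj ->]]//|eh].
by exists h; rewrite eqxx.
Qed.

Lemma colnat_out e t s h : n.*2 <= h -> colnat e t s h = false.
Proof.
move=> le_h; apply/existsP=> -[h' /andP[/eqP eh _]].
by have := ltn_ord h'; rewrite eh ltnNge le_h.
Qed.

Definition column_parity e t s h := prefix_parity (colnat e t s) h.

Section Invariance.
Variable e : node n w -> bool.
Hypothesis e_const : linked_const e.

Lemma colnat_step (t : 'I_(size w)) s (h : nat) :
    ~~ (x.1 t && ((h == nth 0 w t) || (h == (nth 0 w t).+1))) ->
  colnat e (col_left t) s h = colnat e (col_right t) s h.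
Proof.
have [le_h|lt_h] := leqP n.*2 h; first by rewrite !colnat_out.
move=> nv; have [/(_ t s)/forallP/(_ (Ordinal lt_h)) + _] := (linked_constP x e).1 e_const.
by rewrite /= (negbTE nv) -[h]/(Ordinal lt_h : nat) !colnatE => /eqP.
Qed.

Lemma colnat_turn (t : 'I_(size w)) s : x.1 t ->
  colnat e (col_left t) s (nth 0 w t) = colnat e (col_left t) s (nth 0 w t).+1 /\
  colnat e (col_right t) s (nth 0 w t) = colnat e (col_right t) s (nth 0 w t).+1.
Proof.
move=> xt; have lt_k := letter_lt t; pose k1 := Ordinal lt_k; pose k0 := Ordinal (ltnW lt_k).
have [/(_ t s)/forallP/(_ k0) + _] := (linked_constP x e).1 e_const.
rewrite xt /= eqxx /= => /forallP/(_ k1); rewrite /= eqxx /= => /andP[/eqP e1 /eqP e2].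
by rewrite -[nth 0 w t]/(k0 : nat) -[(k0 : nat).+1]/(k1 : nat) !colnatE.
Qed.

(** A vertical uncrossing has two equal values in each column, which cancel unless the count stops
    between them; elsewhere the columns agree. *)
Lemma column_parity_step (t : 'I_(size w)) s (h : nat) :
    ~~ x.1 t || (h != (nth 0 w t).+1) ->
  column_parity e (col_left t) s h = column_parity e (col_right t) s h.
Proof.
have [xt /= nh|xt _] := boolP (x.1 t).
  have [eL eR] := colnat_turn s xt.
  apply: prefix_parity_swap eL eR nh => i nk nk1.
  by apply: colnat_step; rewrite xt (negbTE nk) (negbTE nk1).
by apply: eq_prefix_parity => i _; apply: colnat_step; rewrite (negbTE xt).
Qed.

Lemma colnat_axis (m : 'I_n) h : ~~ x.2 m -> h./2 = m ->
  colnat e ord_max false h = colnat e ord_max true h.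
Proof.
have [le_h|lt_h] := leqP n.*2 h; first by rewrite !colnat_out.
move=> nx hm; have [_ /(_ m)] := (linked_constP x e).1 e_const.
rewrite /axis_ok (negbTE nx) => /forallP/(_ (Ordinal lt_h))/implyP/=.
by rewrite hm eqxx -[h]/(Ordinal lt_h : nat) !colnatE => /(_ isT)/eqP.
Qed.

Lemma colnat_axis_turn (m : 'I_n) s : x.2 m ->
  colnat e ord_max s m.*2 = colnat e ord_max s m.*2.+1.
Proof.
move=> xm; have lt1 : m.*2.+1 < n.*2 by have := ltn_ord m; lia.
pose k1 := Ordinal lt1; pose k0 := Ordinal (ltnW lt1).
have [_ /(_ m)] := (linked_constP x e).1 e_const.
rewrite /axis_ok xm => /forallP/(_ k0)/forallP/(_ k1); rewrite /= !eqxx /=.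
move=> /andP[/eqP e1 /eqP e2].
by rewrite -[m.*2]/(k0 : nat) -[(k0 : nat).+1]/(k1 : nat) !colnatE; case: s.
Qed.

(** On each pair of heights [2m], [2m + 1] the two sides agree after a horizontal uncrossing and
    both sum to zero after a vertical one. *)
Lemma column_parity_axis_even m :
  column_parity e ord_max false m.*2 = column_parity e ord_max true m.*2.
Proof.
apply: prefix_parity_pairs => i _; have [le_ni|lt_in] := leqP n i.
  by rewrite !colnat_out //; lia.
have [xi|xi] := boolP (x.2 (Ordinal lt_in)).
  by rewrite !(colnat_axis_turn (m := Ordinal lt_in)) // !addbb.
by congr (_ (+) _); apply: (colnat_axis xi) => /=; rewrite ?doubleK ?uphalf_double.
Qed.

Lemma column_parity_axis (m : 'I_n) h : ~~ x.2 m -> h./2 = m ->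
  column_parity e ord_max false h = column_parity e ord_max true h.
Proof.
move=> nx hm; have : h = m.*2 \/ h = m.*2.+1 by rewrite -hm; lia.
case=> ->; first exact: column_parity_axis_even.
rewrite /column_parity /= -/(column_parity _ _ _ _) column_parity_axis_even.
by congr (_ (+) _); apply: (colnat_axis nx); rewrite doubleK.
Qed.

Lemma column_parity_total t s :
  column_parity e t s n.*2 = column_parity e ord0 s n.*2.
Proof.
case: t => t lt_t; elim: t lt_t => [|t IHt] lt_t.
  by congr (column_parity e _ s n.*2); apply: ord_inj.
rewrite -(IHt (ltnW lt_t)); have lt_tw : t < size w by [].
have := @column_parity_step (Ordinal lt_tw) s n.*2.
rewrite gtn_eqF ?letter_lt // orbT => /(_ isT).
have -> : col_left (Ordinal lt_tw) = Ordinal (ltnW lt_t) by apply: ord_inj.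
by have -> : col_right (Ordinal lt_tw) = Ordinal lt_t by apply: ord_inj.
Qed.

Lemma column_parity_sides :
  column_parity e ord0 false n.*2 = column_parity e ord0 true n.*2.
Proof. by rewrite -!(column_parity_total ord_max) column_parity_axis_even. Qed.

(* The parity of the number of strands of a component above a point tells on
   which side of that component the point lies; a strand of another component
   never changes side. *)
Definition strand_side (u : node n w) : bool :=
  ~~ e u && column_parity e u.1 u.2.1 u.2.2.

Lemma strand_side_const : linked_const strand_side.
Proof.
(* At a turn, the counts above [h] and [h + 1] differ by the value of [e] at [h]; where that is
   true, [strand_side] is false at both heights. *)
have vert t s (h h' : 'I_n.*2) : h' = h.+1 :> nat -> e (t, (s, h)) = e (t, (s, h')) ->
    strand_side (t, (s, h)) = strand_side (t, (s, h')).
  move=> eh' ee; rewrite /strand_side -ee /= eh' /column_parity /= colnatE.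
  by case: (e _) => //; rewrite addbF.
apply/(linked_constP x strand_side); have [step axis] := (linked_constP x e).1 e_const.
split=> [t s|m].
  apply/forallP=> h; have := forallP (step t s) h; case: ifP => [_|nv].
    move=> /forallP hk; apply/forallP=> h'; apply/implyP=> hh'.
    have := hk h'; rewrite hh' => /andP[/eqP e1 /eqP e2].
    have eh' : h' = h.+1 :> nat by case/andP: hh' => /eqP -> /eqP ->.
    by apply/andP; split; apply/eqP/vert.
  move=> /eqP ee; apply/eqP; rewrite /strand_side /column; congr (~~ _ && _); first exact: ee.
  apply: column_parity_step; move: nv; case: (x.1 t) => //=.
  by case: (h == _.+1 :> nat); rewrite ?orbT.
have := axis m; rewrite /axis_ok; case: ifP => [_|nx].
  move=> /forallP hk; apply/forallP=> h; apply/forallP=> h'; apply/implyP=> hh'.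
  have := forallP (hk h) h'; rewrite hh' => /andP[/eqP e1 /eqP e2].
  have eh' : h' = h.+1 :> nat by case/andP: hh' => /eqP -> /eqP ->.
  by apply/andP; split; apply/eqP/vert.
move=> /forallP hk; apply/forallP=> h; apply/implyP=> hm; have := hk h; rewrite hm => /eqP ee.
apply/eqP; rewrite /strand_side /column; congr (~~ _ && _); first exact: ee.
by apply: (@column_parity_axis m); rewrite ?nx //; apply/eqP.
Qed.

End Invariance.

Definition in_component (u v : node n w) : bool := connect (linked x) u v.

Lemma in_component_const u : linked_const (in_component u).
Proof.
move=> a b ab; apply/idP/idP=> uv; apply: connect_trans uv (connect1 _) => //.
by rewrite linked_sym.
Qed.

Lemma boundary_inj : injective (@boundary n w).
Proof. by move=> p q []. Qed.

(** A component with a single boundary point would have odd parity on one side of the rectangle and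
    even parity on the other, against [column_parity_sides]. *)
Lemma boundary_other_end p :
  exists q, (q != p) && connect (linked x) (boundary w p) (boundary w q).
Proof.
have [q qP|no_q] :=
  pickP (fun q => (q != p) && connect (linked x) (boundary w p) (boundary w q)).
  by exists q.
have := column_parity_sides (in_component_const (boundary w p)).
have colE s h : h < n.*2 ->
    colnat (in_component (boundary w p)) ord0 s h = (s == p.1) && (h == p.2).
  move=> lt_h; rewrite -[h]/(Ordinal lt_h : nat) colnatE.
  apply/idP/idP => [c|/andP[/eqP -> /eqP hp]]; last first.
    by rewrite (_ : Ordinal lt_h = p.2) -?surjective_pairing; [apply: connect0|apply: ord_inj].
  have := no_q (s, Ordinal lt_h); rewrite [connect _ _ _]c andbT => /negbFE/eqP <-.
  by rewrite /= !eqxx.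
rewrite /column_parity (eq_prefix_parity (colE false)) (eq_prefix_parity (colE true)).
by rewrite !prefix_parity1 ltn_ord; case: p.1.
Qed.

(** By the degree bounds a component contains at most two boundary points, and [boundary_other_end]
    supplies the second. *)
Lemma connect_boundary p q : connect (linked x) (boundary w p) (boundary w q) =
  (q == p) || (q == diagram_of x p).
Proof.
have deg a : forall u v, linked x (boundary w a) u -> linked x (boundary w a) v -> u = v.
  by move=> u v; apply: linked_boundary.
have : diagram_of x p != p /\ connect (linked x) (boundary w p) (boundary w (diagram_of x p)).
  rewrite ffunE; case: pickP => [r /andP[]//|no_q].
  by have [r] := boundary_other_end p; rewrite no_q.
set d := diagram_of x p => -[ndp c_d]; apply/idP/idP => [c_q|/orP[]/eqP ->] //.
have := connect_deg_le2 (linked_sym x) (@linked_deg2 _ _ x) (deg p) (deg d) (deg q) _ c_d c_q.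
by rewrite !(inj_eq boundary_inj) eq_sym; apply.
Qed.

Lemma diagram_of_neq p : diagram_of x p != p.
Proof.
rewrite ffunE; case: pickP => [r /andP[]//|no_q].
by have [r] := boundary_other_end p; rewrite no_q.
Qed.

Lemma diagram_ofK : involutive (diagram_of x).
Proof.
move=> p; have c_d : connect (linked x) (boundary w p) (boundary w (diagram_of x p)).
  by rewrite connect_boundary eqxx orbT.
have := c_d; rewrite connect_linked_sym connect_boundary eq_sym (negbTE (diagram_of_neq p)).
by move/eqP/esym.
Qed.

Lemma diagram_of_mirror p : diagram_of x (mirror p) = mirror (diagram_of x p).
Proof.
have := connect_mirror x (boundary w p) (boundary w (diagram_of x p)).
rewrite [RHS]connect_boundary eqxx orbT -[X in connect _ X _]/(boundary w (mirror p)).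
rewrite -[X in connect _ _ X]/(boundary w (mirror (diagram_of x p))) connect_boundary.
case/orP=> /eqP // eq_m; have := diagram_of_neq p.
suff -> : diagram_of x p = p by rewrite eqxx.
by apply: (can_inj (@mirrorK n)).
Qed.

(** The strand from [q] avoids the component of [p], so both its ends lie on the same side of that
    component, whereas a crossing would separate them. *)
Lemma diagram_of_noncrossing p q :
    bpos p < bpos q -> bpos q < bpos (diagram_of x p) ->
  bpos (diagram_of x p) < bpos (diagram_of x q) -> False.
Proof.
move=> lt1 lt2 lt3; pose e := in_component (boundary w p).
have e_const := in_component_const (boundary w p).
have eE r : e (boundary w r) = (r == p) || (r == diagram_of x p) by apply: connect_boundary.
have neq (a b : point n) : bpos a < bpos b -> (a == b) = false.
  by move=> lt_ab; apply: contraTF lt_ab => /eqP ->; rewrite ltnn.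
have colE s h : h < n.*2 -> colnat e ord0 s h =
    ((s == p.1) && (h == p.2)) (+) ((s == (diagram_of x p).1) && (h == (diagram_of x p).2)).
  move=> lt_h; rewrite -[h]/(Ordinal lt_h : nat) colnatE [LHS]eE.
  move: (diagram_of_neq p); case: (diagram_of x p) => [s2 i2]; case: (p) => [s1 i1].
  by rewrite !xpair_eqE -!val_eqE /=; case: s s1 s2 => [] [] [] //=; lia.
have nq : e (boundary w q) = false by rewrite eE eq_sym !neq.
have ndq : e (boundary w (diagram_of x q)) = false.
  by rewrite eE ![diagram_of x q == _]eq_sym !neq //; lia.
have := linked_const_connect (strand_side_const e_const)
  (_ : connect (linked x) (boundary w q) (boundary w (diagram_of x q))).
rewrite connect_boundary eqxx orbT => /(_ isT); rewrite /strand_side -[in_component _]/e nq ndq /=.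
have cp s (h : 'I_n.*2) : column_parity e ord0 s h =
    ((s == p.1) && (p.2 < h)) (+) ((s == (diagram_of x p).1) && ((diagram_of x p).2 < h)).
  rewrite -!prefix_parity1 -prefix_parity_add; apply: eq_prefix_parity => i lt_i.
  by rewrite colE // (ltn_trans lt_i).
rewrite !cp; move: lt1 lt2 lt3; rewrite /bpos.
case: (diagram_of x p) => [sp' i']; case: (p) => [sp i].
case: (diagram_of x q) => [sq' j']; case: (q) => [sq j] /=.
have := ltn_ord i; have := ltn_ord i'; have := ltn_ord j; have := ltn_ord j'.
by case: sp sp' sq sq' => [] [] [] [] /=; lia.
Qed.

Lemma diagram_of_symTL : diagram_of x \in symTL n.
Proof.
rewrite inE; apply/and3P; split.
- by apply/forallP=> p; rewrite diagram_of_neq diagram_ofK eqxx.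
- apply/eqP/setP=> -[p q]; rewrite !inE /=; apply/negP=> /and3P[].
  exact: diagram_of_noncrossing.
- by apply/forallP=> p; rewrite diagram_of_mirror.
Qed.

End DiagramOf.

(** * Directions of the strands *)

Section Directions.
Variables (n : nat) (w : seq nat) (I : {set 'I_n.*2}).
Hypothesis w_ok : all (fun k => k.+1 < n.*2) w.

(* d (t, h) tells whether the strand through the point at height h of column t
   is run through from left to right, once every edge of the diagram is
   oriented from its black to its white end. *)
Definition directions : Type := {ffun 'I_(size w).+1 * 'I_n.*2 -> bool}.

(* A vertical uncrossing reverses the direction and changes the parity of the
   height, a horizontal one keeps both: directions are consistent when their
   sum with the height is constant along the strands. *)
Definition twist (d : directions) (t : 'I_(size w).+1) (h : 'I_n.*2) : bool :=
  d (t, h) (+) odd h.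

Definition twist_node (d : directions) (u : node n w) : bool := twist d u.1 u.2.2.

(** Directions are stored for the left half only: reflecting an oriented edge and reversing it keeps
    its left-to-right direction, so both sides of the axis carry the same column. *)
Definition consistent (d : directions) (x : uncrossing n w) : bool :=
  [forall t : 'I_(size w), step_ok (nth 0 w t) (x.1 t)
                             (twist d (col_left t)) (twist d (col_right t))] &&
  [forall m : 'I_n, axis_ok m (x.2 m) (twist d ord_max) (twist d ord_max)].

Definition starts_with (d : directions) : bool :=
  [forall i, d (ord0, i) == (i \in I)].

Lemma consistentP d x :
  reflect (forall u v, linked x u v -> twist_node d u = twist_node d v) (consistent d x).
Proof.
apply: (iffP andP) => [[/forallP step /forallP axis]|].
  by apply/(linked_constP x (twist_node d)); split=> [t s|m]; [apply: step|apply: axis].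
move/(linked_constP x (twist_node d)) => [step axis].
by split; apply/forallP=> [t]; [apply: (step t false)|apply: axis].
Qed.

Definition boundary_twist (p : point n) : bool := (p.2 \in I) (+) odd p.2.

(** A left edge joins heights of different parity, so keeping the twist amounts to changing
    membership in [I]; a horizontal edge keeps both. *)
Lemma compatible_twistP (D : diagram n) : D \in symTL n ->
  reflect (forall p, boundary_twist (D p) = boundary_twist p) (D \in compatible I).
Proof.
move=> D_sym; apply: (iffP (compatibleP D_sym I)) => [comp [s i]|tw i ni].
  rewrite symTLE // /boundary_twist /= left_partner_parity //.
  have [->|ni] := eqVneq; first by rewrite addbF.
  by rewrite comp //; case: (i \in I); case: (odd i).
have := tw (false, i); rewrite symTLE // /boundary_twist /= left_partner_parity // ni.
by case: (i \in I); case: (odd i); case: (left_partner D i \in I).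
Qed.

(** * Counting the consistent directions of one uncrossing *)

Section Count.
Variable x : uncrossing n w.

Notation boundary := (@boundary n w).
Notation conn := (connect (linked x)).

(** A component together with its mirror image, the unit in which [nloops] counts closed loops. *)
Definition loop_class (u : node n w) : {set node n w} :=
  component x u :|: [set mirror_node v | v in component x u].

Lemma mem_loop_class u v : (v \in loop_class u) = conn u v || conn u (mirror_node v).
Proof.
rewrite inE inE; congr (_ || _); rewrite -[v in LHS]mirror_nodeK.
by rewrite (mem_imset _ _ (inv_inj (@mirror_nodeK n w))) inE.
Qed.

Lemma loop_class_eq u v : v \in loop_class u -> loop_class v = loop_class u.
Proof.
rewrite mem_loop_class => uv; apply/setP=> a; rewrite !mem_loop_class.
have cs := connect_linked_sym x.
case/orP: uv => uv; rewrite !(same_connect cs uv) //.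
by rewrite connect_mirror -(connect_mirror x (mirror_node v) a) mirror_nodeK orbC.
Qed.

Lemma loop_class_refl u : u \in loop_class u.
Proof. by rewrite mem_loop_class connect0. Qed.

Definition loop_classes : {set {set node n w}} :=
  [set C :|: [set mirror_node u | u in C] | C in loops x].

Lemma loop_classesP M :
  reflect (exists2 u, forall p, ~~ conn u (boundary p) & M = loop_class u)
          (M \in loop_classes).
Proof.
apply: (iffP imsetP) => [[C]|[u nbd ->]].
  rewrite inE => /andP[/imsetP[u _ ->] /forallP nbd] ->; exists u => // p.
  by have := nbd p; rewrite inE.
exists (component x u) => //; rewrite inE; apply/andP; split; first exact: imset_f.
by apply/forallP=> p; rewrite inE.
Qed.

Hypothesis x_compat : forall p, boundary_twist (diagram_of x p) = boundary_twist p.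

(** The general solution: a strand reaching the boundary has its twist forced there, while each
    class of closed loops is free, [S] collecting the classes with twist [true]. *)
Definition loop_twist (S : {set {set node n w}}) (u : node n w) : bool :=
  if [pick p | conn u (boundary p)] is Some p then boundary_twist p else loop_class u \in S.

Lemma loop_twist_boundary S u p : conn u (boundary p) -> loop_twist S u = boundary_twist p.
Proof.
rewrite /loop_twist => up; case: pickP => [q uq|/(_ p)]; last by rewrite up.
have : conn (boundary p) (boundary q).
  by rewrite -(same_connect (connect_linked_sym x) up).
by rewrite connect_boundary // => /orP[]/eqP ->.
Qed.

Lemma loop_twist_loop S u :
  (forall p, ~~ conn u (boundary p)) -> loop_twist S u = (loop_class u \in S).
Proof.
by rewrite /loop_twist => no; case: pickP => // p; rewrite (negbTE (no p)).
Qed.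

Lemma loop_twist_class S u v : v \in loop_class u -> loop_twist S v = loop_twist S u.
Proof.
move=> uv; have cs := connect_linked_sym x.
case: (pickP (fun p => conn u (boundary p))) => [p up|no].
  rewrite (loop_twist_boundary _ up); move: uv; rewrite mem_loop_class => /orP[] uv.
    by apply: loop_twist_boundary; rewrite -(same_connect cs uv).
  rewrite (@loop_twist_boundary _ _ (mirror p)) //.
  by rewrite -(connect_mirror x) -(same_connect cs uv) /mirror_node /= /mirror /= negbK;
    case: (p) up.
have nou p : ~~ conn u (boundary p) by rewrite no.
rewrite !loop_twist_loop ?(loop_class_eq uv) // => p.
move: uv; rewrite mem_loop_class => /orP[] uv; first by rewrite -(same_connect cs uv).
have := nou (mirror p); rewrite (same_connect cs uv) -(connect_mirror x) mirror_nodeK.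
by rewrite /mirror_node /= /mirror /= negbK; case: p.
Qed.

Definition loop_directions (S : {set {set node n w}}) : directions :=
  [ffun c => loop_twist S (c.1, (false, c.2)) (+) odd c.2].

Lemma twist_loop_directions S u : twist_node (loop_directions S) u = loop_twist S u.
Proof.
rewrite /twist_node /twist ffunE /= -addbA addbb addbF.
apply: loop_twist_class; rewrite mem_loop_class; case: u => t [[] h] /=.
  by rewrite /mirror_node /mirror /= connect0 orbT.
by rewrite connect0.
Qed.

Lemma twist_node_class d u v :
  consistent d x -> v \in loop_class u -> twist_node d v = twist_node d u.
Proof.
move=> /consistentP d_const; rewrite mem_loop_class => /orP[] uv.
  by rewrite (linked_const_connect d_const uv).
by rewrite (linked_const_connect d_const uv).
Qed.

Lemma card_consistent_compatible :
  #|[set d | starts_with d && consistent d x]| = 2 ^ nloops x.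
Proof.
rewrite -[nloops x]/#|loop_classes| -card_powerset.
rewrite -(card_in_imset (f := loop_directions) (D := powerset loop_classes)) => [|S S'].
  apply: eq_card => d; rewrite inE; apply/andP/imsetP => [[/forallP d0 d_x]|[S _ ->]].
    exists [set M in loop_classes | [exists u in M, twist_node d u]].
      by rewrite inE; apply/subsetP=> M; rewrite inE => /andP[].
    set S := [set M in _ | _]; apply/ffunP=> -[t h]; rewrite ffunE /=.
    rewrite -twist_loop_directions.
    suff -> : twist_node (loop_directions S) (t, (false, h)) = twist_node d (t, (false, h)).
      by rewrite /twist_node /twist /= -addbA addbb addbF.
    rewrite twist_loop_directions; set u := (t, (false, h)).
    case: (pickP (fun p => conn u (boundary p))) => [p up|no].
      have /consistentP d_const := d_x.
      rewrite (loop_twist_boundary _ up) (linked_const_connect d_const up).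
      by rewrite /twist_node /twist (eqP (d0 _)).
    rewrite loop_twist_loop => [|p]; last by rewrite no.
    rewrite inE; apply/andP/idP => [[_ /existsP[v /andP[uv dv]]]|du].
      by rewrite -(twist_node_class d_x uv).
    split; first by apply/loop_classesP; exists u => // p; rewrite no.
    by apply/existsP; exists u; rewrite loop_class_refl.
  split.
    apply/forallP=> i; have := twist_loop_directions S (boundary (false, i)).
    rewrite (@loop_twist_boundary _ _ (false, i)) ?connect0 // /boundary_twist /=.
    by move/(can_inj (addbK (odd i))) => /eqP.
  apply/consistentP=> u v uv; rewrite !twist_loop_directions; apply/esym/loop_twist_class.
  by rewrite mem_loop_class connect1.
rewrite !inE => /subsetP sS /subsetP sS' eqS.
have half M : M \in loop_classes -> (M \in S) = (M \in S').
  case/loop_classesP=> u no ->; rewrite -!loop_twist_loop //.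
  by rewrite -!twist_loop_directions eqS.
apply/setP=> M; have [/half//|nM] := boolP (M \in loop_classes).
by apply/idP/idP=> [/sS|/sS'] MS; rewrite MS in nM.
Qed.

End Count.

(** Consistent directions give the same twist at both ends of every edge, which is possible only for
    a compatible diagram. *)
Lemma card_consistent (x : uncrossing n w) :
  #|[set d | starts_with d && consistent d x]| =
  if diagram_of x \in compatible I then 2 ^ nloops x else 0.
Proof.
have twP := compatible_twistP (diagram_of_symTL x w_ok).
case: ifP => [/twP/card_consistent_compatible //|/twP ntw].
rewrite (_ : [set _ | _] = set0) ?cards0 //; apply/setP=> d; rewrite !inE.
apply/negP=> /andP[/forallP d0 /consistentP d_const]; case: ntw => p.
have twE q : twist_node d (boundary w q) = boundary_twist q.
  by rewrite /twist_node /twist (eqP (d0 _)).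
rewrite -!twE; apply/esym/(linked_const_connect d_const).
by rewrite connect_boundary // eqxx orbT.
Qed.

End Directions.

(** * Summation over the uncrossings *)

Local Open Scope ring_scope.

Section StepWeight.
Variables (N k : nat) (lt_k : (k.+1 < N)%N) (d d' : 'I_N -> bool).

Let k1 := Ordinal lt_k.
Let k0 := Ordinal (ltnW lt_k).
Let c h := d h (+) odd h.
Let c' h := d' h (+) odd h.

(** Vertical needs opposite directions at [k] and [k + 1] in each column, horizontal needs each
    height to keep its direction. If both hold they cancel; what remains is an exchange of opposite
    directions, with sign 1, or two equal directions, with sign -1. *)
Lemma step_weight :
  (step_ok k true c c')%:R - (step_ok k false c c')%:R =
  if [forall h, d' h == d (tperm k0 k1 h)] then (-1) ^+ (d k0 == d k1) else 0 :> int.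
Proof.
pose off := [forall h, (h != k0) && (h != k1) ==> (d h == d' h)].
have dE h : (c h == c' h) = (d h == d' h) by rewrite /c /c'; case: (d h) (d' h) (odd h) => [] [] [].
have nk01 : (k0 == k1) = false by rewrite -val_eqE /= ltn_eqF.
have offP h : off -> h != k0 -> h != k1 -> d h = d' h.
  by move/forallP/(_ h)/implyP => offh n0 n1; apply/eqP/offh; rewrite n0.
have -> : step_ok k true c c' = [&& off, d k0 != d k1 & d' k0 != d' k1].
  apply/forallP/and3P => [ok|[offd dk dk'] h].
    split; first by apply/forallP=> h; apply/implyP=> /andP[n0 n1];
      have := ok h; rewrite -!val_eqE /= in n0 n1 *; rewrite (negbTE n0) (negbTE n1) /= dE.
      have := ok k0; rewrite /= eqxx /= => /forallP/(_ k1); rewrite /= eqxx /=.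
      by rewrite /c /=; case: (d k0) (d k1) (odd k) => [] [] [].
    have := ok k0; rewrite /= eqxx /= => /forallP/(_ k1); rewrite /= eqxx /= => /andP[_].
    by rewrite /c' /=; case: (d' k0) (d' k1) (odd k) => [] [] [].
  case: ifP => /= [_|/norP[n0 n1]]; last by rewrite dE (offP h).
  apply/forallP=> h'; apply/implyP=> /andP[/eqP hk0 /eqP hk1].
  have -> : h = k0 by apply: ord_inj.
  have -> : h' = k1 by apply: ord_inj.
  rewrite /c /c' /=; move: dk dk'.
  by case: (d k0) (d k1) (d' k0) (d' k1) (odd k) => [] [] [] [] [].
have -> : step_ok k false c c' = [&& off, d k0 == d' k0 & d k1 == d' k1].
  apply/forallP/and3P => /= [ok|[offd dk dk'] h].
    by rewrite -!dE !ok; split=> //; apply/forallP=> h; rewrite -dE ok implybT.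
  rewrite dE; have [->//|n0] := eqVneq h k0; have [->//|n1] := eqVneq h k1.
  by rewrite (offP h).
have -> : [forall h, d' h == d (tperm k0 k1 h)] = [&& off, d' k0 == d k1 & d' k1 == d k0].
  apply/forallP/and3P => [ok|[offd dk dk'] h].
    have := ok k0; have := ok k1; rewrite tpermL tpermR => -> ->; split=> //.
    apply/forallP=> h; apply/implyP=> /andP[n0 n1]; have := ok h.
    by rewrite tpermD 1?eq_sym // 1?eq_sym // [d h == _]eq_sym.
  by case: tpermP => [->|->|/eqP n0 /eqP n1] //; rewrite (offP h).
by case: (off); case: (d k0) (d k1) (d' k0) (d' k1) => [] [] [] [].
Qed.

End StepWeight.

(** The horizontal uncrossing is always consistent here, the vertical one exactly for opposite
    directions; on the axis it is the vertical one that carries -1. *)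
Lemma axis_weight (N m : nat) (lt_m : (m.*2.+1 < N)%N) (d : 'I_N -> bool) :
  let c h := d h (+) odd h in
  (axis_ok m false c c)%:R - (axis_ok m true c c)%:R =
  (d (Ordinal (ltnW lt_m)) == d (Ordinal lt_m))%:R :> int.
Proof.
move=> c; have -> : axis_ok m false c c by apply/forallP=> h; rewrite eqxx implybT.
suff -> : axis_ok m true c c = (d (Ordinal (ltnW lt_m)) != d (Ordinal lt_m)) by case: eqP.
set m1 := Ordinal lt_m; set m0 := Ordinal (ltnW lt_m).
have cE : (c m0 == c m1) = (d m0 != d m1).
  by rewrite /c /= odd_double; case: (d m0) (d m1) => [] [].
rewrite -cE; apply/forallP/idP => [/(_ m0)/forallP/(_ m1)|c01 h]; first by rewrite !eqxx => /andP[].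
apply/forallP=> h'; apply/implyP=> /andP[/eqP h0 /eqP h1].
have -> : h = m0 by apply: ord_inj.
by have -> : h' = m1; [apply: ord_inj | rewrite c01].
Qed.

Lemma axis_lt n (m : 'I_n) : (m.*2.+1 < n.*2)%N.
Proof. by have := ltn_ord m; lia. Qed.

Section StateSum.
Variables (n : nat) (w : seq nat) (I : {set 'I_n.*2}).
Hypothesis w_ok : all (fun k => k.+1 < n.*2)%N w.

Definition uncrossing_sign (x : uncrossing n w) : int := (-1) ^+ (uv x + ph x).

Lemma uncrossing_signE x : uncrossing_sign x =
  (\prod_(t < size w) (if x.1 t then 1 else -1)) * \prod_(m < n) (if x.2 m then -1 else 1).
Proof.
have signE (T : finType) (P : pred T) :
    (-1) ^+ #|[set i | P i]| = \prod_i (if P i then -1 else 1) :> int.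
  by rewrite -big_mkcond /= prodr_const cardsE.
rewrite /uncrossing_sign addnC exprD !signE; congr (_ * _).
by apply: eq_bigr => t _; case: (x.1 t).
Qed.

(** Trades the power of two in [wt] for a sum over directions. *)
Lemma wt_consistent x :
  \sum_(d : directions n w | starts_with I d && consistent d x) uncrossing_sign x =
  if diagram_of x \in compatible I then wt x else 0.
Proof.
rewrite sumr_const -cardsE card_consistent //; case: ifP => _; last by rewrite mulr0n.
by rewrite -mulr_natl natrX.
Qed.

(* The only directions that survive the sum over uncrossings: each strand of
   the left half keeps through all its crossings the direction of its left
   end. *)
Definition strand_directions : directions n w :=
  [ffun c : 'I_(size w).+1 * 'I_n.*2 => [exists i in I, height w c.1 i == c.2]].

Lemma heightS t i : (t < size w)%N ->
  height w t.+1 i = swap_heights (nth 0%N w t) (height w t i).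
Proof. by move=> lt_t; rewrite /height (take_nth 0%N) // foldl_rcons. Qed.

Lemma swap_heightsK k : involutive (swap_heights k).
Proof.
move=> h; rewrite /swap_heights.
have [->|n0] := eqVneq h k; first by rewrite gtn_eqF // eqxx.
have [->|n1] := eqVneq h k.+1; first by rewrite eqxx.
by rewrite (negbTE n0) (negbTE n1).
Qed.

Definition letter1 (t : 'I_(size w)) : 'I_n.*2 := Ordinal (letter_lt w_ok t).
Definition letter0 (t : 'I_(size w)) : 'I_n.*2 := Ordinal (ltnW (letter_lt w_ok t)).

Lemma tperm_letters t (h : 'I_n.*2) :
  tperm (letter0 t) (letter1 t) h = swap_heights (nth 0%N w t) h :> nat.
Proof.
rewrite /swap_heights; case: tpermP => [->|->|n0 n1] /=; first by rewrite eqxx.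
  by rewrite gtn_eqF // eqxx.
by rewrite !ifN //; apply/negP=> /eqP eh; [apply: n1|apply: n0]; apply: ord_inj.
Qed.

Definition transported (d : directions n w) (t : 'I_(size w)) : bool :=
  [forall h, d (col_right t, h) == d (col_left t, tperm (letter0 t) (letter1 t) h)].

Lemma strand_directions_starts : starts_with I strand_directions.
Proof.
apply/forallP=> i; rewrite ffunE /height /= take0 /=; apply/eqP; apply/existsP/idP.
  by case=> j /andP[jI /eqP/ord_inj <-].
by move=> iI; exists i; rewrite iI eqxx.
Qed.

Lemma strand_directions_transported t : transported strand_directions t.
Proof.
apply/forallP=> h; rewrite !ffunE /= /bump /= add1n tperm_letters; apply/eqP/eq_existsb => i.
by rewrite heightS // (inv_eq (swap_heightsK _)).
Qed.

Lemma transported_strand_directions d :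
  starts_with I d -> (forall t, transported d t) -> d = strand_directions.
Proof.
move=> d0 dt; apply/ffunP=> -[[t lt_t] h]; elim: t lt_t h => [|t IHt] lt_t h.
  rewrite (_ : Ordinal lt_t = ord0); last exact: ord_inj.
  by rewrite (eqP (forallP d0 h)) (eqP (forallP strand_directions_starts h)).
have lt_tw : (t < size w)%N by [].
have -> : Ordinal lt_t = col_right (Ordinal lt_tw) by apply: ord_inj.
rewrite (eqP (forallP (dt _) h)) (eqP (forallP (strand_directions_transported _) h)).
by have -> : col_left (Ordinal lt_tw) = Ordinal (ltnW lt_t); [apply: ord_inj|apply: IHt].
Qed.

Lemma sum_uncrossings_consistent (d : directions n w) :
  \sum_(x : uncrossing n w | consistent d x) uncrossing_sign x =
  (\prod_t (if transported d t
            then (-1) ^+ (d (col_left t, letter0 t) == d (col_left t, letter1 t)) else 0)) *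
  \prod_(m < n) (d (ord_max, Ordinal (ltnW (axis_lt m))) ==
                 d (ord_max, Ordinal (axis_lt m)))%:R.
Proof.
pose F (t : 'I_(size w)) (b : bool) : int := (if b then 1 else -1) *
  (step_ok (nth 0%N w t) b (twist d (col_left t)) (twist d (col_right t)))%:R.
pose G (m : 'I_n) (b : bool) : int := (if b then -1 else 1) *
  (axis_ok m b (twist d ord_max) (twist d ord_max))%:R.
(* Sign and consistency are both products over the crossings, so the sum over all choices is an
   expanded product of two-term sums. *)
transitivity ((\prod_t \sum_b F t b) * \prod_m \sum_b G m b).
  rewrite !bigA_distr_bigA /= big_distrlr /= pair_bigA /= big_mkcond /=.
  apply: eq_bigr => -[x1 x2] _ /=; rewrite uncrossing_signE /= !big_split /=.
  have forallE (T : finType) (P : pred T) : \prod_i (P i)%:R = [forall i, P i]%:R :> int.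
    have [/forallP allP|] := boolP [forall i, P i]; first by rewrite big1 // => i _; rewrite allP.
    by rewrite negb_forall => /existsP[i nPi]; rewrite (bigD1 i) //= (negbTE nPi) mul0r.
  rewrite !forallE mulrACA -natrM mulnb -/(consistent d (x1, x2)).
  by case: consistent; rewrite ?mulr1 ?mulr0.
congr (_ * _); apply: eq_bigr => t _; rewrite big_bool /F /G /= ?mul1r ?mulN1r.
  exact: (step_weight (letter_lt w_ok t)).
by rewrite addrC; apply: (axis_weight (axis_lt t)).
Qed.

Lemma sum_wt_compatible :
  \sum_(x : uncrossing n w | diagram_of x \in compatible I) wt x =
  (\prod_t (-1) ^+ (strand_directions (col_left t, letter0 t) ==
                    strand_directions (col_left t, letter1 t))) *
  \prod_(m < n) (strand_directions (ord_max, Ordinal (ltnW (axis_lt m))) ==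
                 strand_directions (ord_max, Ordinal (axis_lt m)))%:R.
Proof.
rewrite big_mkcond /=; under eq_bigr => x _ do rewrite -wt_consistent.
rewrite (exchange_big_dep (starts_with I)) /= => [|x d _ /andP[]//].
under eq_bigr => d d0 do under eq_bigl => x do rewrite d0 /=.
under eq_bigr => d d0 do rewrite sum_uncrossings_consistent.
(* Any other directions fail to be transported at some crossing, whose factor is then zero. *)
rewrite (bigD1 strand_directions) ?strand_directions_starts //= [X in _ + X]big1 ?addr0.
  by congr (_ * _); apply: eq_bigr => t _; rewrite strand_directions_transported.
move=> d /andP[d0 nd]; suff [t nt] : exists t, ~~ transported d t.
  by rewrite (bigD1 t) //= (negbTE nt) !mul0r.
apply/existsP; rewrite -negb_forall; apply: contra nd => /forallP dt.
by rewrite (transported_strand_directions d0 dt).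
Qed.

End StateSum.

Local Close Scope ring_scope.

(** * Parity of the crossings *)

Notation "\xor_ ( i 'in' A ) F" := (\big[addb/false]_(i in A) F)
  (at level 36, F at level 36, i, A at level 50).

Lemma xor_split (T : Type) (r : seq T) (P F G : pred T) :
  \big[addb/false]_(i <- r | P i) (F i (+) G i) =
  \big[addb/false]_(i <- r | P i) F i (+) \big[addb/false]_(i <- r | P i) G i.
Proof. exact: big_split. Qed.

Lemma odd_card_xor (T : finType) (A : {pred T}) : odd #|A| = \big[addb/false]_i (i \in A).
Proof.
rewrite -sum1_card big_mkcond (big_morph odd oddD (erefl : odd 0 = false)).
by apply: eq_bigr => i _; case: (i \in A).
Qed.

Lemma xor_pairs N (J : {set 'I_N}) (F : 'I_N -> 'I_N -> bool) : (forall i, F i i = false) ->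
  \xor_(i in J) \xor_(j in J) F i j =
  \xor_(i in J) \xor_(j in J) ((i < j) && (F i j (+) F j i)).
Proof.
move=> Fii.
transitivity (\xor_(i in J) (\xor_(j in J) ((i < j) && F i j) (+)
                             \xor_(j in J) ((j < i) && F i j))).
  apply: eq_bigr => i _; rewrite -xor_split /=; apply: eq_bigr => j _ /=.
  by case: ltngtP => [||/ord_inj ->] /=; rewrite ?addbF ?Fii.
rewrite xor_split /= [X in _ (+) X]exchange_big /= -xor_split /=.
apply: eq_bigr => i _; rewrite -xor_split /=; apply: eq_bigr => j _ /=.
by rewrite andb_addr.
Qed.

Section ArcParity.
Variables (N : nat) (pi : 'I_N -> 'I_N) (J : {set 'I_N}) (h : 'I_N -> nat).
Hypothesis piK : involutive pi.
Hypothesis pi_neq : forall i, pi i != i.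
Hypothesis piJ : forall i, (pi i \in J) = (i \in J).
Hypothesis h_inj : injective h.
Hypothesis h_pi : forall i, (h i)./2 = (h (pi i))./2.
Hypothesis h_lt : forall i : 'I_N, (i < pi i) = (h i < h (pi i)).

Let arc_cross (a c : 'I_N) : bool := [&& a < c, c < pi a & pi a < pi c].

Lemma xor_arcs (F : 'I_N -> bool) :
  \xor_(i in J) F i = \big[addb/false]_(a in J | (a < pi a)%N) (F a (+) F (pi a)).
Proof.
rewrite (bigID (fun a : 'I_N => a < pi a)) xor_split /=; congr (_ (+) _).
rewrite [RHS](reindex_inj (inv_inj piK)) /=; apply: eq_big => [i|i _]; last by rewrite piK.
rewrite piJ piK; congr (_ && _); have := pi_neq i; rewrite -val_eqE /=; lia.
Qed.

(* Sort the arcs by the height of their ends on the axis: the four pairs of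
   ends of two arcs contain an odd number of inversions iff the arcs cross. *)
Lemma inversions_crossings :
  \xor_(i in J) \xor_(j in J) ((i < j) && (h j < h i)) =
  \xor_(a in J) \xor_(c in J) arc_cross a c.
Proof.
pose m i := (h i)./2.
have vneq (i j : 'I_N) : i <> j -> i <> j :> nat by move=> nij /ord_inj.
have hneq (i j : 'I_N) : i <> j -> h i <> h j by move=> nij /h_inj.
(* If arc [c] reaches the axis above arc [a], the inversions are the pairs with an end of [a] before
   an end of [c]: 1 or 3 for crossing arcs, 0, 2 or 4 otherwise. Within one arc [h_lt] excludes
   inversions. *)
transitivity (\big[addb/false]_(a in J | a < pi a) \big[addb/false]_(c in J | c < pi c)
                ((m c < m a) && (arc_cross a c (+) arc_cross c a))).
  rewrite xor_arcs; apply: eq_bigr => a /andP[_ lt_a].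
  rewrite !xor_arcs -xor_split; apply: eq_bigr => c /andP[_ lt_c] /=.
  have ha := h_pi a; have hc := h_pi c; have la := h_lt a; have lc := h_lt c.
  rewrite /m /arc_cross; have [->|nac] := eqVneq a c; first by rewrite !ltnn; lia.
  have nac' : a <> c by apply/eqP.
  have na_pc : a <> pi c by move=> e; move: lt_a; rewrite e piK; lia.
  have npa_c : pi a <> c by move=> e; move: lt_c; rewrite -e piK; lia.
  have npac : pi a <> pi c by move/(can_inj piK).
  have := vneq _ _ nac'; have := vneq _ _ na_pc; have := vneq _ _ npa_c; have := vneq _ _ npac.
  have := hneq _ _ nac'; have := hneq _ _ na_pc; have := hneq _ _ npa_c; have := hneq _ _ npac.
  have := hneq _ _ (elimN eqP (pi_neq a)); have := hneq _ _ (elimN eqP (pi_neq c)).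
  lia.
(* Regroup by the arc that starts first; distinct arcs reach distinct points of the axis, so each
   crossing is counted once. *)
transitivity (\big[addb/false]_(a in J | a < pi a) (\big[addb/false]_(c in J | c < pi c)
                ((m c < m a) && arc_cross a c) (+)
                \big[addb/false]_(c in J | c < pi c) ((m a < m c) && arc_cross a c))).
  rewrite xor_split /= [X in _ = _ (+) X]exchange_big /=.
  rewrite -xor_split /=; apply: eq_bigr => a _; rewrite -xor_split; apply: eq_bigr => c _ /=.
  by rewrite andb_addr.
rewrite [RHS](bigID (fun a : 'I_N => a < pi a)) /= [X in _ = _ (+) X]big1 ?addbF => [|a /andP[_ na]].
  apply: eq_bigr => a _; rewrite -xor_split [RHS](bigID (fun c : 'I_N => c < pi c)) /=.
  rewrite [X in _ = _ (+) X]big1 ?addbF => [|c /andP[_ nc]]; last by rewrite /arc_cross; lia.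
  apply: eq_bigr => c _; rewrite -andb_addl; have [x_ac|] := boolP (arc_cross a c); last by rewrite andbF.
  rewrite andbT /m; have ha := h_pi a; have hc := h_pi c.
  have na_pa := hneq _ _ (elimN eqP (pi_neq a)).
  have nac : a <> c by move=> e; move: x_ac; rewrite /arc_cross e ltnn.
  have npac : pi a <> c by move=> e; move: x_ac; rewrite /arc_cross e ltnn andbF.
  have := hneq _ _ nac; have := hneq _ _ npac; lia.
by rewrite big1 // => c _; rewrite /arc_cross; lia.
Qed.

End ArcParity.

(** * Crossings of the strands in the left half and their vertical order *)

Section Heights.
Variables (n : nat) (w : seq nat).
Hypothesis w_ok : all (fun k => k.+1 < n.*2) w.

Lemma height_lt t i : t <= size w -> i < n.*2 -> height w t i < n.*2.
Proof.
elim: t => [|t IHt] lt_t lt_i; first by rewrite /height take0.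
rewrite heightS //; have := IHt (ltnW lt_t) lt_i.
have := allP w_ok _ (mem_nth 0 lt_t); rewrite /swap_heights /=.
by case: ifP => // _; case: ifP => // _; lia.
Qed.

Lemma height_inj t i j : t <= size w -> height w t i = height w t j -> i = j.
Proof.
elim: t => [|t IHt] lt_t; first by rewrite /height take0.
rewrite !heightS // => /(can_inj (@swap_heightsK _)); exact: IHt (ltnW lt_t).
Qed.

Lemma height_surj t h : t <= size w -> h < n.*2 -> exists i : 'I_n.*2, height w t i = h.
Proof.
move=> le_t lt_h.
pose ht (i : 'I_n.*2) : 'I_n.*2 := Ordinal (height_lt le_t (ltn_ord i)).
have ht_inj : injective ht by move=> i j /(congr1 val)/= /(height_inj le_t)/ord_inj.
exists (invF ht_inj (Ordinal lt_h)).
by have := f_invF ht_inj (Ordinal lt_h) => /(congr1 val).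
Qed.

Lemma strand_directions_height (I : {set 'I_n.*2}) (t : 'I_(size w).+1) (h i : 'I_n.*2) :
  h = height w t i :> nat -> strand_directions w I (t, h) = (i \in I).
Proof.
move=> eh; rewrite ffunE /=; apply/existsP/idP => [[j /andP[jI /eqP]]|iI].
  by rewrite eh => /height_inj-/(_ (ltn_ord t))/ord_inj <-.
by exists i; rewrite iI eh eqxx.
Qed.

Definition upper_lower (t i j : nat) : bool :=
  (height w t i == nth 0 w t) && (height w t j == (nth 0 w t).+1).

(** Each crossing of the two strands reverses their vertical order, so the parity of their crossings
    compares the initial and final orders. *)
Lemma upper_lower_parity (i j : nat) : i != j ->
  \big[addb/false]_(t < size w) (upper_lower t i j (+) upper_lower t j i) =
  (i < j) (+) (height w (size w) i < height w (size w) j).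
Proof.
move=> nij; rewrite -(big_mkord predT (fun t => upper_lower t i j (+) upper_lower t j i)).
have : size w <= size w by []; elim: {1 3 4 5}(size w) => [|t IHt] lt_t.
  by rewrite big_geq // /height take0 addbb.
rewrite big_nat_recr //= IHt ?(ltnW lt_t) // !heightS // -addbA; congr (_ (+) _).
have : height w t i <> height w t j by move/(height_inj (ltnW lt_t)); apply/eqP.
rewrite /upper_lower /swap_heights; move: (height w t i) (height w t j) (nth 0 w t) => a b k.
case: (eqVneq a k) => /= ?; case: (eqVneq a k.+1) => /= ?;
  case: (eqVneq b k) => /= ?; case: (eqVneq b k.+1) => /= ?; lia.
Qed.

Lemma xor_upper_lower (J : {set 'I_n.*2}) :
  \big[addb/false]_(t < size w) \xor_(i in J) \xor_(j in J) upper_lower t i j =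
  \xor_(i in J) \xor_(j in J) ((i < j) && (height w (size w) j < height w (size w) i)).
Proof.
rewrite exchange_big /=; under eq_bigr => i _ do rewrite exchange_big /=.
rewrite (@xor_pairs _ _ (fun i j => \big[addb/false]_(t < size w) upper_lower t i j)) => [|i].
  apply: eq_bigr => i _; apply: eq_bigr => j _; rewrite -xor_split.
  have [lt_ij|//] := boolP (i < j); rewrite upper_lower_parity ?lt_ij /=; last by rewrite ltn_eqF.
  have : height w (size w) i <> height w (size w) j.
    by move/(height_inj (leqnn _)) => ij; rewrite ij ltnn in lt_ij.
  by lia.
by rewrite big1 // => t _; rewrite /upper_lower; lia.
Qed.

(** Exactly one ordered pair of strands meets at the [t]-th crossing; the directions agree when both
    strands start in [I] or both outside. *)
Lemma letters_same_direction (I : {set 'I_n.*2}) (t : 'I_(size w)) :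
  (strand_directions w I (col_left t, letter0 w_ok t) ==
   strand_directions w I (col_left t, letter1 w_ok t)) =
  (\xor_(i in I) \xor_(j in I) upper_lower t i j) (+)
  (\xor_(i in ~: I) \xor_(j in ~: I) upper_lower t i j).
Proof.
have le_t : t <= size w := ltnW (ltn_ord t).
have [i hi] := height_surj le_t (ltnW (letter_lt w_ok t)).
have [j hj] := height_surj le_t (letter_lt w_ok t).
rewrite (@strand_directions_height _ _ _ i) // (@strand_directions_height _ _ _ j) //.
have xorE (J : {set 'I_n.*2}) :
    \xor_(a in J) \xor_(b in J) upper_lower t a b = (i \in J) && (j \in J).
  have ulE (a b : 'I_n.*2) : upper_lower t a b = (a == i) && (b == j).
    rewrite /upper_lower -hj -[X in (_ == X) && _]hi; congr (_ && _); apply/eqP/eqP => [|-> //];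
      by move/(height_inj le_t)/ord_inj.
  have x1 (a : 'I_n.*2) (b : bool) : \xor_(c in J) ((c == a) && b) = (a \in J) && b.
    rewrite big_mkcond /= (bigD1 a) //= eqxx big1 ?addbF => [|c /negbTE ->]; last by case: ifP.
    by case: (a \in J).
  under eq_bigr => a _ do under eq_bigr => b _ do rewrite ulE andbC.
  under eq_bigr => a _ do rewrite x1 andbC.
  by rewrite x1.
by rewrite !xorE !inE; case: (i \in I); case: (j \in I).
Qed.

Lemma meets_eq0 (i j : nat) : meets w i j = 0 -> i != j ->
  (i < j) = (height w (size w) i < height w (size w) j).
Proof.
move=> /eqP; rewrite sum_nat_eq0 => /forallP no nij; have := upper_lower_parity nij.
rewrite big1 => [/esym|t _]; first by lia.
have : ~~ perm_eq [:: height w t i; height w t j] [:: nth 0 w t; (nth 0 w t).+1].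
  by have := no t; rewrite /= eqb0.
rewrite /upper_lower; case: andP => [[/eqP -> /eqP ->]|_]; first by rewrite perm_refl.
by case: andP => [[/eqP -> /eqP ->]|_] //; rewrite (perm_catC [:: _] [:: _]) perm_refl.
Qed.

End Heights.

Definition crossings_in N (pi : {ffun 'I_N -> 'I_N}) (J : {set 'I_N}) : {set 'I_N * 'I_N} :=
  [set p in crossings (@nat_of_ord N) pi | (p.1 \in J) && (p.2 \in J)].

Lemma odd_card_crossings_in N (pi : {ffun 'I_N -> 'I_N}) (J : {set 'I_N}) :
  odd #|crossings_in pi J| =
  \xor_(a in J) \xor_(c in J) [&& a < c, c < pi a & pi a < pi c].
Proof.
rewrite odd_card_xor pair_big /= [RHS]big_mkcond; apply: eq_bigr => -[a c] _ /=.
by rewrite !inE /= andbC; case: ifP.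
Qed.

(** * The signed count for a nice embedding *)

Section NiceEmbedding.
Variables (n : nat) (pi : {ffun 'I_n.*2 -> 'I_n.*2}) (w : seq nat).
Hypotheses (pi_matching : perfect_matching pi) (w_nice : nice_embedding pi w).

Let w_ok : all (fun k => k.+1 < n.*2) w.
Proof. by case: w_nice. Qed.

Lemma matchingK : involutive pi.
Proof. by move=> i; move/forallP/(_ i)/andP: pi_matching => [_ /eqP]. Qed.

Lemma matching_neq i : pi i != i.
Proof. by move/forallP/(_ i)/andP: pi_matching => []. Qed.

Let h (i : 'I_n.*2) : nat := height w (size w) i.

Let h_inj : injective h.
Proof. by move=> i j /height_inj-/(_ (leqnn _))/ord_inj. Qed.

Let h_pi i : (h i)./2 = (h (pi i))./2.
Proof. by case: w_nice => _ + _; apply. Qed.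

(** The edge from [i] and its mirror image already meet on the axis, so their strands do not cross
    in the left half. *)
Let h_lt (i : 'I_n.*2) : (i < pi i) = (h i < h (pi i)).
Proof.
case: w_nice => _ _ /(_ i (pi i)); rewrite eq_sym matching_neq eqxx => /(_ isT) meet.
by apply: (meets_eq0 w_ok); [lia | rewrite eq_sym val_eqE matching_neq].
Qed.

(** The strands at heights [2m] and [2m + 1] on the axis start at some [i] and [pi i], so each
    factor tests one arc of [pi]. *)
Lemma axis_same_direction (I : {set 'I_n.*2}) :
  (\prod_(m < n) (strand_directions w I (ord_max, Ordinal (ltnW (axis_lt m))) ==
                  strand_directions w I (ord_max, Ordinal (axis_lt m)))%:R =
   [forall i, (pi i \in I) == (i \in I)]%:R :> int)%R.
Proof.
have h_lt2 i : h i < n.*2 by apply: (height_lt w_ok (leqnn _)).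
have ends i : (h i = (h i)./2.*2 /\ h (pi i) = (h i)./2.*2.+1) \/
              (h (pi i) = (h i)./2.*2 /\ h i = (h i)./2.*2.+1).
  have := h_pi i; have : h i <> h (pi i) by move/h_inj/esym/eqP; rewrite (negbTE (matching_neq i)).
  by lia.
have sdE (k : 'I_n.*2) j : h j = k -> strand_directions w I (ord_max, k) = (j \in I).
  by move=> hj; apply: strand_directions_height; rewrite -hj.
have mP (m : 'I_n) i : (h i)./2 = m ->
    (strand_directions w I (ord_max, Ordinal (ltnW (axis_lt m))) ==
     strand_directions w I (ord_max, Ordinal (axis_lt m))) = ((pi i \in I) == (i \in I)).
  move=> him; case: (ends i) => -[h1 h2]; rewrite him in h1 h2.
    by rewrite (sdE (Ordinal _) _ h1) (sdE (Ordinal _) _ h2) eq_sym.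
  by rewrite (sdE (Ordinal _) _ h1) (sdE (Ordinal _) _ h2).
have [/forallP closed|] := boolP [forall i, (pi i \in I) == (i \in I)].
  rewrite big1 // => m _.
  have [i him] := height_surj w_ok (leqnn _) (axis_lt m).
  by rewrite (mP m i) ?closed //= /h him /= uphalf_double.
rewrite negb_forall => /existsP[i ni].
have lt_m : (h i)./2 < n by have := h_lt2 i; lia.
by rewrite (bigD1 (Ordinal lt_m)) // (mP (Ordinal lt_m) i erefl) (negbTE ni) /= mul0r.
Qed.

Lemma sum_wt_matching (I : {set 'I_n.*2}) :
  (\sum_(x : uncrossing n w | diagram_of x \in compatible I) wt x =
   if [forall i, (pi i \in I) == (i \in I)]
   then (-1) ^+ (#|crossings_in pi I| + #|crossings_in pi (~: I)|) else 0)%R.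
Proof.
rewrite (sum_wt_compatible _ w_ok) axis_same_direction.
case: ifP => [/forallP closed|_]; last by rewrite mulr0.
rewrite mulr1 prodrXr -signr_odd -[RHS]signr_odd; congr (_ ^+ (nat_of_bool _))%R.
rewrite (big_morph odd oddD (erefl : odd 0 = false)) oddD !odd_card_crossings_in.
under eq_bigr => t _ do rewrite oddb letters_same_direction.
rewrite xor_split !xor_upper_lower //.
congr (_ (+) _); apply: (inversions_crossings (pi := pi) matchingK matching_neq _ h_inj h_pi h_lt).
  by move=> i; apply/eqP.
by move=> i; rewrite !inE (eqP (closed i)).
Qed.

End NiceEmbedding.

(** * Products of pfaffians *)

Lemma enum_val_lt N (J : {set 'I_N}) (r s : 'I_#|J|) :
  (enum_val r < enum_val s) = (r < s).
Proof.
have homo (a b : 'I_#|J|) : a < b -> enum_val a < enum_val b.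
  move=> lt_ab; have x0 : 'I_N := enum_val a.
  have srt : sorted (fun i j : 'I_N => i < j) (enum J).
    rewrite /enum_mem -enumT; apply: sorted_filter => [i j k|]; first exact: ltn_trans.
    by have := iota_ltn_sorted 0 N; rewrite -val_enum_ord sorted_map.
  have tr : transitive (fun i j : 'I_N => i < j) by move=> i j k; apply: ltn_trans.
  have sz (c : 'I_#|J|) : (c : nat) \in [pred m | m < size (enum J)] by rewrite inE -cardE.
  rewrite (enum_val_nth x0 a) (enum_val_nth x0 b).
  exact: (sorted_ltn_nth tr x0 srt _ _ (sz a) (sz b)).
have [lt_rs|lt_sr|eq_rs] := ltngtP r s.
- exact: homo.
- by apply/negbTE; rewrite -leqNgt ltnW // homo.
- by rewrite (ord_inj eq_rs) ltnn.
Qed.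

Lemma enum_val_ex N (J : {set 'I_N}) i : i \in J -> exists r : 'I_#|J|, enum_val r = i.
Proof. by move=> iJ; exists (enum_rank_in iJ i); rewrite enum_rankK_in. Qed.

Definition closed_on N (J : {set 'I_N}) (pi : {ffun 'I_N -> 'I_N}) : bool :=
  [forall i, (pi i \in J) == (i \in J)].

Lemma closed_on_setC N (J : {set 'I_N}) pi : closed_on (~: J) pi = closed_on J pi.
Proof. by apply: eq_forallb => i; rewrite !inE (inj_eq negb_inj). Qed.

(** Meant for [pi] preserving [J]; a value outside [J] would be replaced by the default of
    [enum_rank_in]. *)
Definition restriction N (J : {set 'I_N}) (pi : {ffun 'I_N -> 'I_N}) :
    {ffun 'I_#|J| -> 'I_#|J|} :=
  [ffun r => enum_rank_in (enum_valP r) (pi (enum_val r))].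

Section Restriction.
Variables (R : comNzRingType) (N : nat) (J : {set 'I_N}) (pi : {ffun 'I_N -> 'I_N}).
Hypothesis pi_closed : closed_on J pi.

Lemma restrictionE r : enum_val (restriction J pi r) = pi (enum_val r).
Proof.
rewrite ffunE enum_rankK_in //.
by move/forallP/(_ (enum_val r))/eqP: pi_closed => ->; apply: enum_valP.
Qed.

Lemma restriction_matching :
  perfect_matching (restriction J pi) =
  [forall i in J, (pi i != i) && (pi (pi i) == i)].
Proof.
have valE r s : (r == s) = (enum_val r == enum_val s :> 'I_N).
  by rewrite (inj_eq enum_val_inj).
apply/forallP/forall_inP => [pm i iJ|pm r].
  have [r <-] := enum_val_ex iJ; have := pm r.
  by rewrite !valE !restrictionE.
by rewrite !valE !restrictionE; apply: pm; apply: enum_valP.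
Qed.

Lemma cn_restriction : cn (restriction J pi) = #|crossings_in pi J|.
Proof.
pose f (p : 'I_#|J| * 'I_#|J|) : 'I_N * 'I_N := (enum_val p.1, enum_val p.2).
have f_inj : injective f by move=> [a b] [c d] [/enum_val_inj -> /enum_val_inj ->].
rewrite /cn -(card_imset _ f_inj); apply: eq_card => -[a c]; rewrite inE /=.
have fE r s : (f (r, s) \in crossings (@nat_of_ord N) pi) =
              ((r, s) \in crossings (@nat_of_ord #|J|) (restriction J pi)).
  by rewrite !inE /= -!enum_val_lt !restrictionE.
apply/imsetP/andP => [[[r s] rs [-> ->]]|[ac /andP[aJ cJ]]].
  by rewrite !enum_valP -[(_, _)]/(f (r, s)) fE.
have [r er] := enum_val_ex aJ; have [s es] := enum_val_ex cJ.
by exists (r, s); rewrite -?fE /f /= er es.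
Qed.

Lemma match_weight_restriction (A : 'M[R]_N) :
  (match_weight (mxsub (@enum_val _ (mem J)) (@enum_val _ (mem J)) A) (restriction J pi) =
   \prod_(i in J | (i < pi i)%N) A i (pi i))%R.
Proof.
rewrite /match_weight [RHS]big_enum_val_cond.
apply: eq_big => [r|r _]; first by rewrite -enum_val_lt restrictionE.
by rewrite mxE restrictionE.
Qed.

End Restriction.

Section Glue.
Variables (N : nat) (J : {set 'I_N}).

(** Inverse of taking both restrictions. Every point lies in [J] or its complement, so the last
    default is never reached. *)
Definition glue (fg : {ffun 'I_#|J| -> 'I_#|J|} * {ffun 'I_#|~: J| -> 'I_#|~: J|}) :
    {ffun 'I_N -> 'I_N} :=
  [ffun i => if [pick r | enum_val r == i] is Some r then enum_val (fg.1 r)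
             else if [pick r | enum_val r == i] is Some r then enum_val (fg.2 r) else i].

Lemma pick_enum_val (K : {set 'I_N}) (r : 'I_#|K|) :
  [pick s | enum_val s == enum_val r] = Some r.
Proof. by case: pickP => [s /eqP/enum_val_inj -> //|/(_ r)]; rewrite eqxx. Qed.

Lemma glue_in fg r : glue fg (enum_val r) = enum_val (fg.1 r).
Proof. by rewrite ffunE pick_enum_val. Qed.

Lemma glue_out fg r : glue fg (enum_val r) = enum_val (fg.2 r).
Proof.
rewrite ffunE; case: pickP => [s /eqP e|_]; last by rewrite pick_enum_val.
by have := enum_valP r; rewrite inE -e enum_valP.
Qed.

Lemma glue_closed fg : closed_on J (glue fg).
Proof.
apply/forallP=> i; have [iJ|iJ] := boolP (i \in J).
  by have [r <-] := enum_val_ex iJ; rewrite glue_in enum_valP.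
have : i \in ~: J by rewrite inE.
case/enum_val_ex=> r <-; rewrite glue_out.
by have := enum_valP (fg.2 r); rewrite inE => /negbTE ->.
Qed.

Lemma glue_restriction pi : closed_on J pi ->
  glue (restriction J pi, restriction (~: J) pi) = pi.
Proof.
move=> clJ; have clC : closed_on (~: J) pi by rewrite closed_on_setC.
apply/ffunP=> i; have [iJ|iJ] := boolP (i \in J).
  by have [r <-] := enum_val_ex iJ; rewrite glue_in restrictionE.
have : i \in ~: J by rewrite inE.
by case/enum_val_ex=> r <-; rewrite glue_out restrictionE.
Qed.

Lemma restriction_glue fg : (restriction J (glue fg), restriction (~: J) (glue fg)) = fg.
Proof.
have clJ := glue_closed fg; have clC : closed_on (~: J) (glue fg) by rewrite closed_on_setC.
case: fg clJ clC => f g clJ clC; congr (_, _); apply/ffunP=> r; apply: enum_val_inj.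
  by rewrite restrictionE // glue_in.
by rewrite restrictionE // glue_out.
Qed.

End Glue.

Local Open Scope ring_scope.

(** Pairs of matchings of [I] and its complement correspond to matchings preserving [I]; crossings
    between the two parts do not enter the sign. *)
Lemma pf_pairE (R : comNzRingType) N (I : {set 'I_N}) (A : 'M[R]_N) :
  pf_pair I A =
  \sum_(pi : {ffun 'I_N -> 'I_N} | perfect_matching pi && closed_on I pi)
    (-1) ^+ (#|crossings_in pi I| + #|crossings_in pi (~: I)|) * match_weight A pi.
Proof.
rewrite /pf_pair /pf_sub /pf big_distrlr pair_big /=.
rewrite (reindex_onto (fun pi => (restriction I pi, restriction (~: I) pi)) (@glue N I)) /=;
  last by move=> fg _; apply: restriction_glue.
apply: eq_big => [pi|pi /andP[_ /eqP pi_glue]].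
  have [clI|ncl] := boolP (closed_on I pi); last first.
    rewrite !andbF; apply: contraNF ncl => /andP[_ /eqP <-]; exact: glue_closed.
  have clC : closed_on (~: I) pi by rewrite closed_on_setC.
  rewrite glue_restriction // eqxx !andbT !restriction_matching //.
  apply/andP/forallP => [[/forall_inP pmI /forall_inP pmC] i|pm].
    by have [/pmI//|iI] := boolP (i \in I); apply: pmC; rewrite inE.
  by split; apply/forall_inP=> i _; apply: pm.
have clI : closed_on I pi by rewrite -pi_glue; apply: glue_closed.
have clC : closed_on (~: I) pi by rewrite closed_on_setC.
rewrite !cn_restriction // !match_weight_restriction // mulrACA -exprD; congr (_ * _).
rewrite /match_weight [RHS](bigID (mem I)) /=.
by congr (_ * _); apply: eq_bigl => i; rewrite ?inE andbC.
Qed.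

Lemma sum_fcoef (n : nat) (w : seq nat) (P : {set diagram n}) :
  \sum_(D in P) fcoef w D = \sum_(x : uncrossing n w | diagram_of x \in P) wt x.
Proof.
rewrite [RHS](partition_big (@diagram_of n w) (mem P)) //=.
apply: eq_bigr => D DP; apply: eq_bigl => x.
by case: eqP => [->|]; rewrite ?DP ?andbF.
Qed.

Theorem theorem13 (R : comNzRingType) (n : nat) (n_gt0 : (0 < n)%N)
    (emb : {ffun 'I_n.*2 -> 'I_n.*2} -> seq nat)
    (emb_nice : forall pi : {ffun 'I_n.*2 -> 'I_n.*2},
       perfect_matching pi -> nice_embedding pi (emb pi))
    (A : 'M[R]_n.*2) (A_skew : A^T = - A)
    (I : {set 'I_n.*2}) (I_even : ~~ odd #|I|) :
  pf_pair I A = \sum_(D in compatible_max I) Pfaf emb D A.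
Proof.
(* Exchanging the sums reduces the identity to comparing, for each [pi], the coefficients of
   [match_weight A pi]. *)
rewrite pf_pairE /Pfaf sum_compatible_max // exchange_big /= big_mkcondr /=.
apply: eq_bigr => pi pi_matching; rewrite -big_distrl /= -rmorph_sum.
rewrite sum_fcoef (sum_wt_matching pi_matching (emb_nice pi pi_matching)).
by rewrite -/(closed_on I pi); case: ifP => _; rewrite ?rmorph_sign ?mul0r.
Qed.
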